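(* Let $\mathfrak{t}_{n,k}=C_0^n\prod_{i=1}^rC_i^{k_i}\prod_{j=1}^JA_j(n,k)!^{\epsilon_j}$ be a balanced hypergeometric term with Newton polytope $P_{\mathfrak{t}}$ compact with nonempty interior, and let $V_{\mathfrak{t}}(w)=\log C_0+\sum_{i=1}^rw_i\log C_i+\sum_{j=1}^J\epsilon_jA_j(w)\log A_j(w)$, viewed as an analytic function on the universal abelian cover $\varpi:\hat{\mathbb{C}}^r\to\mathbb{C}^r\setminus\mathcal{A}_{\mathfrak{t}}$, where $\mathcal{A}_{\mathfrak{t}}=\{w\in\mathbb{C}^r:\prod_jA_j(w)=0\}$. Then: (a) $\varpi^{-1}(X_{\mathfrak{t}})$ coincides with the set of critical points of $V_{\mathfrak{t}}$. (b) If $w$ is a critical point of $V_{\mathfrak{t}}$, then $$e^{-V_{\mathfrak{t}}(w)}=C_0^{-1}\prod_{j=1}^JA_j(w)^{-\epsilon_jv_0(A_j)}=C_0^{-1}\prod_{j:A_j(w)\ne0}A_j(w)^{-\epsilon_jv_0(A_j)}.$$ Thus $\mathrm{CV}_{\mathfrak{t}}$ coincides with the set $\{e^{-V}: V \text{ a critical value of } V_{\mathfrak{t}}\}$. (c) For every face $\Delta$ of $P_{\mathfrak{t}}$, $V_{(\mathfrak{t}|_\Delta)}=(V_{\mathfrak{t}})|_\Delta$. (d) $S_{\mathfrak{t}}$ is a finite subset of $\bar{\mathbb{Q}}$ and $K_{\mathfrak{t}}=\mathbb{Q}(S_{\mathfrak{t}})$ is a number field.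
   Context: $n\in\mathbb{N}$, $k\in\mathbb{Z}^r$; $C_i$ nonzero algebraic numbers, $\epsilon_j\in\{1,-1\}$, $A_j$ integral linear forms with $\sum_j\epsilon_jA_j=0$. For $A(n,k)=a_0n+\sum_ia_ik_i$: $v_i(A)=a_i$ ($i=0,\dots,r$), and $A(w)=a_0+\sum_ia_iw_i$. $P_{\mathfrak{t}}=\{w\in\mathbb{R}^r:A_j(w)\ge0\ \forall j\}$. Variational equations: $C_i\prod_{j}A_j(w)^{\epsilon_jv_i(A_j)}=1$, $i=1,\dots,r$; $X_{\mathfrak{t}}$ is the set of complex solutions ($X_{\mathfrak{t}}=\{0\}$ if $r=0$). $\mathrm{CV}_{\mathfrak{t}}=\{C_0^{-1}\prod_{j:A_j(w)\ne0}A_j(w)^{-\epsilon_jv_0(A_j)}:w\in X_{\mathfrak{t}}\}$. For a face $\Delta$ of $P_{\mathfrak{t}}$, $\mathfrak{t}|_\Delta$ is the balanced term obtained by substituting an integral affine parametrization of the lattice points of the cone over $\Delta$ into $\mathfrak{t}$, and $(V_{\mathfrak{t}})|_\Delta$ is $V_{\mathfrak{t}}$ composed with the corresponding parametrization of the affine span of $\Delta$. $S_{\mathfrak{t}}=\{0\}\cup\bigcup_{\Delta\text{ face of }P_{\mathfrak{t}}}\mathrm{CV}_{\mathfrak{t}|_\Delta}$.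
   Formalization: Critical points in (a) and critical values in (b) are taken for some determination of the log C_i; (c) reads V_{t|Δ} = d·(V_t)|_Δ, d the least positive n of a lattice point in the span of the cone over Δ; identically zero forms A_j are ignored in the arrangement. *)

(* Defs.v *)
From HB Require Import structures.
From mathcomp Require Import all_boot all_order all_algebra.
From mathcomp Require Import all_classical all_reals all_analysis.
From mathcomp Require Import complex.

Set Implicit Arguments.
Unset Strict Implicit.
Unset Printing Implicit Defensive.

Import Order.TTheory GRing.Theory Num.Theory.
Import numFieldNormedType.Exports.

Local Open Scope classical_set_scope.
Local Open Scope ring_scope.

(* R[i] packed as a numClosedFieldType: the topology and norm of
   mathcomp-analysis are keyed on the structure, not on the type complex R. *)
Definition CC (R : realType) : numClosedFieldType := R[i].

Definition cexp (R : realType) (z : CC R) : CC R :=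
  let: (a +i* b)%C := (z : R[i]) in
  ((expR a * cos b) +i* (expR a * sin b))%C.

Definition algebraic_number (R : realType) (z : CC R) : Prop :=
  algebraicOver (ratr : rat -> CC R) z.

(* Covering of an open subset B of X. The open sheets over U are the images of
   U under the sections s i. *)
Definition covering_map (E X : topologicalType) (B : set X) (p : E -> X) :
    Prop :=
  [/\ continuous p, range p = B &
    forall b, B b -> exists (U : set X) (I : Type) (s : I -> X -> E),
      [/\ open U, U b, U `<=` B &
        [/\ forall i x, U x -> {for x, continuous (s i)},
            forall i x, U x -> p (s i x) = x,
            forall i, open (s i @` U) &
            forall e, U (p e) -> exists! i, s i (p e) = e]]].

Definition deck_transformation (E X : topologicalType) (p : E -> X)
    (f : E -> E) : Prop :=
  [/\ continuous f, p \o f = p &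
    exists g : E -> E, [/\ continuous g, cancel f g & cancel g f]].

Definition abelian_cover (E X : topologicalType) (B : set X) (p : E -> X) :
    Prop :=
  [/\ covering_map B p, connected [set: E],
      forall e e', p e = p e' -> exists2 f, deck_transformation p f & f e = e' &
      forall f g, deck_transformation p f -> deck_transformation p g ->
        f \o g = g \o f].

Definition universal_abelian_cover (E X : topologicalType) (B : set X)
    (p : E -> X) : Prop :=
  abelian_cover B p /\
  forall (E' : topologicalType) (p' : E' -> X), abelian_cover B p' ->
    forall e e', p e = p' e' ->
      exists h : E -> E', [/\ continuous h, p' \o h = p & h e = e'].

(* E carries the complex structure lifted from C^r, so the differential of V at
   e is read through a local section s of p; the germ of s at p e is unique. *)
Definition critical_point (R : realType) (r : nat) (E : topologicalType)
    (p : E -> 'rV[CC R]_r) (V : E -> CC R) (e : E) : Prop :=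
  exists s : 'rV[CC R]_r -> E,
    [/\ s (p e) = e, {for p e, continuous s},
        \forall w \near p e, p (s w) = w &
        is_diff (p e) (V \o s) (fun=> 0)].

(* The data of C_0^n prod_i C_i^{k_i} prod_j A_j(n,k)!^{eps_j}. Index 0 of
   'I_r.+1 belongs to n and index i+1 (lift ord0 i) to k_i. *)
Record hyp_term (R : realType) (r : nat) := HypTerm {
  tJ : nat;
  tC : 'I_r.+1 -> CC R;
  tA : 'I_tJ -> 'rV[int]_r.+1;
  teps : 'I_tJ -> int
}.
Arguments tC {R r} _ _.
Arguments tA {R r} _ _.
Arguments teps {R r} _ _.

Definition balanced (R : realType) (r : nat) (t : hyp_term R r) : Prop :=
  [/\ forall i, tC t i != 0,
      forall i, algebraic_number (tC t i),
      forall j, teps t j = 1 \/ teps t j = -1 &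
      \sum_j teps t j *: tA t j = 0].

Definition vcoef (r : nat) (i : 'I_r.+1) (A : 'rV[int]_r.+1) : int := A 0 i.

(* A(w) = a_0 + sum_i a_i w_i *)
Definition dehom (F : pzRingType) (r : nat) (A : 'rV[int]_r.+1)
    (w : 'rV[F]_r) : F :=
  (vcoef ord0 A)%:~R + \sum_(i < r) (vcoef (lift ord0 i) A)%:~R * w 0 i.

(* The value at (n,k) = x; meaningful when all A_j(x) >= 0. *)
Definition term_val (R : realType) (r : nat) (t : hyp_term R r)
    (x : 'rV[int]_r.+1) : CC R :=
  (\prod_i tC t i ^ x 0 i) *
  \prod_j (absz ((x *m (tA t j)^T) 0 0))`!%:R ^ teps t j.

Definition newton_polytope (R : realType) (r : nat) (t : hyp_term R r) :
    set 'rV[R]_r :=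
  [set w | forall j, 0 <= dehom (tA t j) w].

(* Identically zero forms contribute the constant factor 0! = 1 (and 0 log 0 = 0
   to the potential) and define no hyperplane. They occur in every restriction
   to a proper face. *)
Definition arrangement (R : realType) (r : nat) (t : hyp_term R r) :
    set 'rV[CC R]_r :=
  [set w | exists2 j, tA t j != 0 & dehom (tA t j) w = 0].

(* Since 0 ^ m = 0 for every nonzero m : int, including m < 0, points at which
   a factor with nonzero exponent vanishes are not solutions. *)
Definition variational_solutions (R : realType) (r : nat) (t : hyp_term R r) :
    set 'rV[CC R]_r :=
  [set w | forall i : 'I_r,
    tC t (lift ord0 i) *
    \prod_j dehom (tA t j) w ^ (teps t j * vcoef (lift ord0 i) (tA t j)) = 1].

Definition CV (R : realType) (r : nat) (t : hyp_term R r) : set (CC R) :=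
  [set (tC t ord0)^-1 *
    \prod_(j | dehom (tA t j) w != 0)
      dehom (tA t j) w ^ (- (teps t j * vcoef ord0 (tA t j)))
  | w in variational_solutions t].

(* lC i and lA j stand for log C_i and log A_j(w). *)
Definition potential (R : realType) (r : nat) (t : hyp_term R r)
    (lC : 'I_r.+1 -> CC R) (lA : 'I_(tJ t) -> CC R) (w : 'rV[CC R]_r) : CC R :=
  lC ord0 + \sum_(i < r) w 0 i * lC (lift ord0 i) +
  \sum_j (teps t j)%:~R * dehom (tA t j) w * lA j.
Arguments potential {R r} t lC lA w.

(* Any determination of the logs is allowed: a point over X_t satisfies
   log C_i + sum_j eps_j v_i(A_j) log A_j(w) in 2 pi i Z, and is critical for V_t
   only after a suitable choice of log C_1, ..., log C_r. *)
Definition log_constants (R : realType) (r : nat) (t : hyp_term R r)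
    (lC : 'I_r.+1 -> CC R) : Prop :=
  forall i, cexp (lC i) = tC t i.

(* Branches of log A_j(f(e)) on E. Where A_j(f(e)) = 0 the value of lA j e is
   irrelevant, as it is multiplied by A_j(f(e)) in the potential. *)
Definition log_branches (R : realType) (r : nat) (t : hyp_term R r)
    (E : topologicalType) (f : E -> 'rV[CC R]_r)
    (lA : 'I_(tJ t) -> E -> CC R) : Prop :=
  forall j, continuous (lA j) /\
    forall e, dehom (tA t j) (f e) != 0 ->
      cexp (lA j e) = dehom (tA t j) (f e).
Arguments log_branches {R r} t {E} f lA.

(* V_t pulled back along f : E -> C^r. *)
Definition lifted_potential (R : realType) (r : nat) (t : hyp_term R r)
    (E : topologicalType) (f : E -> 'rV[CC R]_r) (lC : 'I_r.+1 -> CC R)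
    (lA : 'I_(tJ t) -> E -> CC R) : E -> CC R :=
  fun e => potential t lC (lA ^~ e) (f e).
Arguments lifted_potential {R r} t {E} f lC lA e.

Definition potential_branches (R : realType) (r : nat) (t : hyp_term R r)
    (E : topologicalType) (f : E -> 'rV[CC R]_r) (lC : 'I_r.+1 -> CC R) :
    set (E -> CC R) :=
  [set lifted_potential t f lC lA | lA in log_branches t f].
Arguments potential_branches {R r} t {E} f lC.

Definition is_face (R : realType) (r : nat) (P D : set 'rV[R]_r) : Prop :=
  D !=set0 /\
  exists (c : 'rV[R]_r) (b : R),
    let f (w : 'rV[R]_r) := \sum_i c 0 i * w 0 i in
    (forall w, P w -> f w <= b) /\ D = P `&` [set w | f w = b].

Definition homog (F : pzRingType) (r : nat) (w : 'rV[F]_r) : 'rV[F]_r.+1 :=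
  row_mx (1%:M : 'rV[F]_1) w.

(* Linear span in R^{1+r} of the cone {(n, n w) : n >= 0, w in D}. *)
Definition cone_span (R : realType) (r : nat) (D : set 'rV[R]_r) :
    set 'rV[R]_r.+1 :=
  [set x | exists (N : nat) (c : 'I_N -> R) (w : 'I_N -> 'rV[R]_r),
    (forall i, D (w i)) /\ x = \sum_i c i *: homog (w i)].

(* x' |-> x' *m phi is a parametrization (n', k') |-> (n, k) = (d n', n' p + k' B)
   of the lattice spanned by the lattice points of the cone over D, with
   d = phi 0 0; d = 1 exactly when the affine span of D contains a point of Z^r. *)
Definition face_param (R : realType) (r s : nat) (D : set 'rV[R]_r)
    (phi : 'M[int]_(s.+1, r.+1)) : Prop :=
  [/\ 0 < phi ord0 ord0,
      forall l : 'I_s, phi (lift ord0 l) ord0 = 0,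
      injective (fun x : 'rV[int]_s.+1 => x *m phi) &
      forall y : 'rV[int]_r.+1,
        cone_span D (map_mx intr y) <-> exists x, y = x *m phi].

(* The parametrization w' |-> (p + w' B) / d of the affine span of D. *)
Definition affine_param (F : fieldType) (r s : nat)
    (phi : 'M[int]_(s.+1, r.+1)) (w : 'rV[F]_s) : 'rV[F]_r :=
  \row_i (dehom (col (lift ord0 i) phi)^T w / (phi ord0 ord0)%:~R).

Definition restrict_term (R : realType) (r s : nat) (t : hyp_term R r)
    (phi : 'M[int]_(s.+1, r.+1)) : hyp_term R s :=
  {| tC := fun l => \prod_i tC t i ^ phi l i;
     tA := fun j => tA t j *m phi^T;
     teps := teps t |}.

Definition restrict_logs (R : realType) (r s : nat)
    (phi : 'M[int]_(s.+1, r.+1)) (lC : 'I_r.+1 -> CC R) : 'I_s.+1 -> CC R :=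
  fun l => \sum_i (phi l i)%:~R * lC i.

Lemma term_val_restrict (R : realType) (r s : nat) (t : hyp_term R r)
    (phi : 'M[int]_(s.+1, r.+1)) (x : 'rV[int]_s.+1) :
  (forall i, tC t i != 0) ->
  term_val (restrict_term t phi) x = term_val t (x *m phi).
Proof.
move=> C0; rewrite /term_val /=; congr (_ * _); last first.
  by apply: eq_bigr => j _; rewrite trmx_mul trmxK mulmxA.
transitivity (\prod_(l < s.+1) \prod_(i < r.+1) tC t i ^ (x 0 l * phi l i)).
  apply: eq_bigr => l _; 
  rewrite (big_morph (fun a => a ^ x 0 l) (fun a b => expfzMl a b _) (exp1rz _ _)).
  by apply: eq_bigr => i _; rewrite exprz_exp mulrC.
rewrite exchange_big; apply: eq_bigr => i _; rewrite mxE.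
by rewrite (big_morph _ (fun a b => expfzDr a b (C0 i)) (expr0z _)).
Qed.

Lemma balanced_restrict (R : realType) (r s : nat) (t : hyp_term R r)
    (phi : 'M[int]_(s.+1, r.+1)) :
  balanced t -> balanced (restrict_term t phi).
Proof.
case=> C0 Calg eps1 bal; split => //=.
- by move=> l; rewrite prodf_seq_neq0; apply/allP => i _ /=; rewrite expfz_neq0.
- move=> l; apply: (big_ind (@algebraic_number R)).
  + exact: algebraic1.
  + by move=> a b; apply: algebraic_mul.
  + move=> i _.
    have pw n : algebraic_number (tC t i ^+ n).
      elim: n => [|n IHn]; first exact: algebraic1.
      rewrite exprS; exact: algebraic_mul (Calg i) IHn.
    by case: (phi l i) => n; [exact: pw | apply: algebraic_inv; exact: pw].
- transitivity ((\sum_j teps t j *: tA t j) *m phi^T); last by rewrite bal mul0mx.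
  by rewrite mulmx_suml; apply: eq_bigr => j _; rewrite scalemxAl.
Qed.

Definition S_set (R : realType) (r : nat) (t : hyp_term R r) : set (CC R) :=
  [set 0] `|`
  [set z | exists (D : set 'rV[R]_r) (s : nat) (phi : 'M[int]_(s.+1, r.+1)),
    [/\ is_face (newton_polytope t) D, face_param D phi &
        CV (restrict_term t phi) z]].

Definition is_subfield (F : fieldType) (K : set F) : Prop :=
  [/\ K 1, forall x y, K x -> K y -> K (x - y) &
      forall x y, K x -> K y -> K (x / y)].

Definition generated_field (F : fieldType) (S : set F) : set F :=
  [set z | forall K : set F, is_subfield K -> S `<=` K -> K z].

Definition number_field (R : realType) (K : set (CC R)) : Prop :=
  is_subfield K /\
  exists (n : nat) (b : 'I_n -> CC R),
    forall z, K z -> exists q : 'I_n -> rat, z = \sum_i ratr (q i) * b i.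

(* Main.v *)
(* A branch of log A_j only needs to be continuous at a point to be
   differentiable there, so the differential of V_t in a local section of the
   cover is sum_i (log C_i + sum_j eps_j v_i(A_j) log A_j(w)) dw_i: the extra term
   sum_j eps_j dA_j vanishes because t is balanced. Exponentiating its
   coefficients gives the variational equations, and Euler's relation gives the
   critical values.

   For (d), let z be a value attained at w in X_t. If z were transcendental,
   there would be a derivation D, trivial on algebraic numbers and defined on a
   field containing z and w, with D z = 1; applying D logarithmically to the
   variational equations yields D z = 0. Hence every value is algebraic. On the
   other hand CV_t is constructible, so by quantifier elimination it is finite or
   cofinite, and a cofinite set contains transcendental numbers. Finally, faces
   are determined by their sets of active forms, and two parametrizations of one
   face differ by a unimodular matrix, which does not change CV. *)

Require Import Defs.
From HB Require Import structures.
From mathcomp Require Import all_boot all_order all_algebra.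
From mathcomp Require Import separable closed_field.
From mathcomp Require Import all_classical all_reals all_analysis.
From mathcomp Require Import complex.
From mathcomp Require Import ring lra zify.
Import Order.TTheory GRing.Theory Num.Theory.
Import numFieldNormedType.Exports.
Local Open Scope classical_set_scope.
Local Open Scope ring_scope.

Set Implicit Arguments.
Unset Strict Implicit.
Unset Printing Implicit Defensive.

(** * The complex exponential: surjectivity onto nonzero numbers and first-order behaviour at 0 *)

Section ComplexExponential.
Context {R : realType}.
Implicit Types x y z : CC R.

Lemma cexpD x y : cexp (x + y) = cexp x * cexp y.
Proof.
case: x y => [a b] [c d]; rewrite /cexp /= expRD cosD sinD.
by apply/eqP; rewrite eq_complex /=; apply/andP; split; apply/eqP; ring.
Qed.

Lemma cexp0 : cexp (0 : CC R) = 1.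
Proof. by rewrite /cexp /= expR0 cos0 sin0 mul1r mulr0. Qed.

Lemma cexpN x : cexp (- x) = (cexp x)^-1.
Proof.
have e1 : cexp (- x) * cexp x = 1 by rewrite -cexpD addNr cexp0.
have ex0 : cexp x != 0.
  by apply: contra_eq_neq e1 => ->; rewrite mulr0 eq_sym oner_eq0.
by rewrite -[LHS](mulfK ex0) e1 mul1r.
Qed.

Lemma cexp_sum (I : Type) (s : seq I) (P : pred I) (F : I -> CC R) :
  cexp (\sum_(i <- s | P i) F i) = \prod_(i <- s | P i) cexp (F i).
Proof. exact: (big_morph _ cexpD cexp0). Qed.

Lemma cexpMz (m : int) x : cexp (m%:~R * x) = cexp x ^ m.
Proof.
have nat_case n y : cexp (n%:R * y) = cexp y ^+ n.
  elim: n => [|n IHn]; first by rewrite mul0r cexp0.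
  by rewrite -natr1 mulrDl mul1r cexpD IHn -exprSr.
case: m => n; first by rewrite -pmulrn nat_case.
by rewrite NegzE mulrNz mulNr cexpN -pmulrn nat_case exprnN.
Qed.

(** Polar form: the real part of the logarithm is [ln rho], and the argument is [acos (a / rho)] up
    to the sign of b. *)
Lemma cexp_surj z : z != 0 -> exists x, cexp x = z.
Proof.
case: z => [a b] z0.
have ab0 : 0 < a ^+ 2 + b ^+ 2.
  rewrite lt_neqAle addr_ge0 ?sqr_ge0 // andbT eq_sym paddr_eq0 ?sqr_ge0 //.
  by rewrite !sqrf_eq0; move: z0; rewrite eq_complex /=.
pose rho := Num.sqrt (a ^+ 2 + b ^+ 2).
have rho0 : 0 < rho by rewrite sqrtr_gt0.
have rho2 : rho ^+ 2 = a ^+ 2 + b ^+ 2 by rewrite sqr_sqrtr // ltW.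
have rhon0 : rho != 0 by rewrite gt_eqF.
have arho : (a / rho) ^+ 2 + (b / rho) ^+ 2 = 1.
  by rewrite !exprMn -mulrDl -rho2 -exprMn divff // expr1n.
have a1 : -1 <= a / rho <= 1.
  by move: arho; set u := a / rho; set v := b / rho => ?; apply/andP; split; nra.
have sa : sin (acos (a / rho)) = `|b / rho|.
  by rewrite sin_acos // -arho addrAC subrr add0r sqrtr_sqr.
have ca : cos (acos (a / rho)) = a / rho by rewrite acosK.
have el : expR (ln rho) = rho by rewrite lnK.
have cancel_rho c : rho * (c / rho) = c by rewrite mulrC divfK.
have [b0|b0] := leP 0 b.
  exists (ln rho +i* acos (a / rho))%C; rewrite /cexp /= el ca sa.
  by rewrite ger0_norm ?divr_ge0 ?(ltW rho0) // !cancel_rho.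
exists (ln rho +i* - acos (a / rho))%C; rewrite /cexp /= el cosN sinN ca sa.
rewrite ler0_norm ?opprK ?cancel_rho //.
by rewrite pmulr_lle0 ?invr_gt0 // ltW.
Qed.


(** Multiplying the difference quotient by |h| gives an o(h) estimate that also covers h = 0. *)
Lemma is_derive_near0 (f : R -> R) (d : R) : is_derive (0 : R) 1 f d ->
  forall e, 0 < e -> \forall h \near (0 : R), `|f h - f 0 - d * h| <= e * `|h|.
Proof.
case=> df dE e e0.
have : h^-1 *: (f (h *: 1 + 0) - f 0) @[h --> (0 : R)^'] --> d.
  by rewrite -dE; exact: df.
move=> /cvgr_dist_le /(_ e e0); rewrite near_withinE; apply: filterS => h /= H.
have [->|h0] := eqVneq h 0; first by rewrite subrr mulr0 subr0 normr0 mulr0.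
have := H h0; rewrite /GRing.scale /= mulr1 addr0 => H1.
rewrite -(@ler_pM2r _ `|h|) ?normr_gt0 // -normrM mulrBl in H1.
by move: H1; rewrite mulrAC mulVf // mul1r distrC.
Qed.

Lemma normc_le_ReIm (a b : R) : `|(a +i* b)%C : CC R| <= (`|a| + `|b|)%:C%C.
Proof.
rewrite normc_def lecR /= -(@ler_sqr _ (Num.sqrt _)) ?nnegrE ?sqrtr_ge0 ?addr_ge0 //.
rewrite sqr_sqrtr ?addr_ge0 ?sqr_ge0 // sqrrD !real_normK ?num_real //.
by have := mulr_ge0 (normr_ge0 a) (normr_ge0 b); lra.
Qed.

Lemma normRe_le_normc (a b : R) : `|a|%:C%C <= `|(a +i* b)%C : CC R|.
Proof. by rewrite normc_def lecR /= -sqrtr_sqr ler_wsqrtr // lerDl sqr_ge0. Qed.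

Lemma normIm_le_normc (a b : R) : `|b|%:C%C <= `|(a +i* b)%C : CC R|.
Proof. by rewrite normc_def lecR /= -sqrtr_sqr ler_wsqrtr // lerDr sqr_ge0. Qed.

(** Reduces to the real expansions of exp, cos and sin at 0, applied to the real and imaginary
    parts; this is differentiability of [cexp] at 0 with derivative 1. *)
Lemma cexp_near0 (e : CC R) : 0 < e ->
  \forall u \near (0 : CC R), `|cexp u - 1 - u| <= e * `|u|.
Proof.
move=> e0.
(* A positive element of the complex order is real. *)
have eE : e = (complex.Re e)%:C%C.
  by move: e0; case: (e) => a b; rewrite ltcE /= => /andP[/eqP -> _].
set e1 := complex.Re _ in eE.
have e10 : 0 < e1 by move: e0; rewrite eE ltcR.
(* The errors add up to at most 5 e1 / 12 times |a| + |b|, and |a| + |b| <= 2 |u|, so e1 / 12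
   suffices. *)
have e120 : 0 < e1 / 12 by rewrite divr_gt0.
have : \forall h \near (0 : R), [/\ `|expR h - 1 - h| <= e1 / 12 * `|h|,
    `|cos h - 1| <= e1 / 12 * `|h|, `|sin h - h| <= e1 / 12 * `|h|
    & `|expR h - 1| <= Num.min 1 (e1 / 12)].
  have /is_derive_near0 /(_ _ e120) He := is_derive_expR (0 : R).
  have /is_derive_near0 /(_ _ e120) Hc := is_derive_cos (0 : R).
  have /is_derive_near0 /(_ _ e120) Hs := is_derive_sin (0 : R).
  have m0 : 0 < Num.min 1 (e1 / 12) by rewrite lt_min ltr01 e120.
  have /cvgr_dist_le /(_ _ m0) Hx : expR h @[h --> (0 : R)] --> expR (0 : R).
    exact: continuous_expR.
  move: He Hc Hs Hx; rewrite expR0 cos0 sin0 oppr0 => He Hc Hs Hx.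
  apply: filterS2 (filterI He Hc) (filterI Hs Hx) => h [].
  rewrite mul1r mul0r !subr0 => ? ? []; rewrite addr0 mul1r => ? ?.
  by split => //; rewrite distrC.
move=> /(@nbhs_norm0P R R)[d /= d0 Hd].
apply/(@nbhs_norm0P (CC R) (CC R)); exists d%:C%C; first by rewrite /= ltcR.
case=> a b /= ud.
have /Hd[ea _ _ ea1] : `|a| < d.
  by rewrite -ltcR; exact: le_lt_trans (normRe_le_normc a b) ud.
have /Hd[_ cb sb _] : `|b| < d.
  by rewrite -ltcR; exact: le_lt_trans (normIm_le_normc a b) ud.
have -> : cexp (a +i* b)%C - 1 - (a +i* b)%C =
    ((expR a * cos b - 1 - a) +i* (expR a * sin b - b))%C :> CC R.
  by apply/eqP; rewrite eq_complex /= oppr0 addr0 !eqxx.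
apply: le_trans (normc_le_ReIm _ _) _; rewrite eE.
have nab : (e1 / 2 * (`|a| + `|b|))%:C%C <= e1%:C%C * `|(a +i* b)%C : CC R|.
  rewrite -mulrA (rmorphM (real_complex R)).
  apply: ler_wpM2l; first by rewrite lecR ltW.
  rewrite (rmorphM (real_complex R)) fmorphV rmorph_nat ler_pdivrMl ?ltr0n //.
  rewrite mulr_natl mulr2n (rmorphD (real_complex R)).
  by rewrite lerD ?normRe_le_normc ?normIm_le_normc.
apply: le_trans nab; rewrite lecR.
move: ea1; rewrite le_min => /andP[ea1 ea2].
have ea3 : `|expR a| <= 2.
  rewrite -[expR a](subrK 1); apply: le_trans (ler_normD _ _) _; rewrite normr1; lra.
have h1 : `|expR a * cos b - 1 - a| <= e1 / 12 * `|a| + 2 * (e1 / 12 * `|b|).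
  have -> : expR a * cos b - 1 - a = (expR a - 1 - a) + expR a * (cos b - 1) by ring.
  by apply: le_trans (ler_normD _ _) _; rewrite lerD // normrM ler_pM.
have h2 : `|expR a * sin b - b| <= 2 * (e1 / 12 * `|b|) + e1 / 12 * `|b|.
  have -> : expR a * sin b - b = expR a * (sin b - b) + (expR a - 1) * b by ring.
  by apply: le_trans (ler_normD _ _) _; rewrite lerD // normrM ler_pM.
have := normr_ge0 a; have := normr_ge0 b; nra.
Qed.

End ComplexExponential.

(** * Differentials characterised by first-order estimates *)

Section DifferentialFacts.
Context {K : numFieldType} {V W : normedModType K}.

(** Uniqueness of the linear part of a first-order expansion identifies [l] with the
    differential. *)
Lemma is_diff_linear_approx (f : V -> W) (l : {linear V -> W}) (x : V) :
  continuous l ->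
  (forall e, 0 < e ->
    \forall h \near (0 : V), `|f (h + x) - f x - l h| <= e * `|h|) ->
  is_diff x f l.
Proof.
move=> lc fl.
have fo : f \o shift x = cst (f x) + l +o_ 0 id.
  apply/eqaddoP => e e0; have := fl e e0; apply: filterS => h /=.
  by rewrite -addrA -opprD.
have dE := diff_unique lc fo.
by split => //; apply/diff_locallyP; rewrite dE.
Qed.

Lemma is_diff_approx (f df : V -> W) (x : V) : is_diff x f df ->
  forall e, 0 < e ->
    \forall h \near (0 : V), `|f (h + x) - f x - df h| <= e * `|h|.
Proof.
case=> fx <- e e0; have /eqaddoP/(_ e e0) := diff_locally fx.
by apply: filterS => h /=; rewrite -addrA -opprD.
Qed.

Lemma is_diff_unique (f df dg : V -> W) (x : V) :
  is_diff x f df -> is_diff x f dg -> df = dg.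
Proof. by case=> _ <- [_ <-]. Qed.

Lemma near_eq_is_diff (f g dg : V -> W) (x : V) :
  (\forall y \near x, f y = g y) -> is_diff x g dg -> is_diff x f dg.
Proof.
move=> fg dgx; have [gx gE] := dgx.
rewrite -gE; apply: is_diff_linear_approx; first exact: diff_continuous.
move=> e e0; rewrite gE.
have fgx : f x = g x := nbhs_singleton fg.
move: fg; rewrite (near_shift 0) => fg.
have := is_diff_approx dgx e0; apply: filterS2 fg => h /=.
by rewrite subr0 fgx => ->.
Qed.

Lemma is_diff_sum (n : nat) (f df : 'I_n -> V -> W) (x : V) :
  (forall i, is_diff x (f i) (df i)) ->
  is_diff x (fun y => \sum_i f i y) (fun y => \sum_i df i y).
Proof.
move=> H; elim: n => [|n IHn] in f df H *.
  rewrite (_ : (fun y => _) = cst 0); last by apply/funext => y; rewrite big_ord0.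
  rewrite (_ : (fun y => _) = 0); first exact: is_diff_cst.
  by apply/funext => y; rewrite big_ord0.
rewrite (_ : (fun y => \sum_i f i y) =
    f ord0 + fun y => \sum_i f (lift ord0 i) y); last first.
  by apply/funext => y; rewrite big_ord_recl.
rewrite (_ : (fun y => \sum_i df i y) =
    df ord0 + fun y => \sum_i df (lift ord0 i) y); last first.
  by apply/funext => y; rewrite big_ord_recl.
exact: is_diffD (H ord0) (IHn _ _ (fun i => H (lift ord0 i))).
Qed.

End DifferentialFacts.

Lemma is_diff_coord (K : numFieldType) (r : nat) (x : 'rV[K]_r) (i : 'I_r) :
  is_diff x (fun w : 'rV[K]_r => w 0 i : K) (fun w : 'rV[K]_r => w 0 i : K).
Proof.
have l_lin : linear (fun w : 'rV[K]_r => w 0 i : K).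
  by move=> a u v; rewrite !mxE.
pose lM := GRing.isLinear.Build _ _ _ _ _ l_lin.
pose l : {linear 'rV[K]_r -> K} := HB.pack (fun w : 'rV[K]_r => w 0 i : K) lM.
apply: (@is_diff_linear_approx _ _ _ _ l); first exact: coord_continuous.
move=> e e0; near=> h; rewrite /= mxE addrK subrr normr0 mulr_ge0 // ltW //.
Unshelve. all: by end_near. Qed.

(** Supplies the tolerance for the exponential in the differentiation of logarithms: d <= 1/2 lets
    an error d |u| be absorbed in |u|, and d * 2M <= e / 2 leaves half of the error e. *)
Lemma small_half_multiple (F : numFieldType) (e M : F) : 0 < e -> 0 < M ->
  exists2 d, 0 < d & d <= 2^-1 /\ d * (2 * M) <= e / 2.
Proof.
move=> e0 M0; have M20 : 0 < 2 * M by rewrite mulr_gt0.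
have eM0 : 0 < e + 2 * M by rewrite addr_gt0.
exists (e / (2 * (e + 2 * M))); first by rewrite divr_gt0 // mulr_gt0.
split; first by rewrite ler_pdivrMr ?mulr_gt0 // mulKf ?pnatr_eq0 // lerDl ltW.
have -> : e / (2 * (e + 2 * M)) * (2 * M) = e / 2 * ((2 * M) / (e + 2 * M)).
  by rewrite invfM (mulrA e) -(mulrA (e / 2)) (mulrC _ (2 * M)).
apply: ler_piMr; first by rewrite divr_ge0 // ltW.
by rewrite ler_pdivrMr // mul1r lerDr ltW.
Qed.

(* A branch of the logarithm of f only has to be continuous at x: then
   u = log f(x+h) - log f(x) tends to 0 and e^u - 1 - u = o(u). *)
Lemma is_diff_log (R : realType) (V : normedModType (CC R))
    (f df L : V -> CC R) (x : V) :
  is_diff x f df -> f x != 0 -> {for x, continuous L} ->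
  (\forall w \near x, cexp (L w) = f w) ->
  is_diff x L (fun h => (f x)^-1 * df h).
Proof.
move=> [fx <-] fx0 Lc Lf.
have fdf : is_diff x f ('d f x) by [].
have dfc : continuous ('d f x) by exact: diff_continuous.
have [k k0 dfk] : exists2 k : CC R, 0 < k & forall y, `|'d f x y| <= k * `|y|.
  exact: linear_lipschitz.
have -> : (fun h => (f x)^-1 * 'd f x h) = (f x)^-1 \*: 'd f x by [].
apply: is_diff_linear_approx.
  by move=> y; apply: cvgZr; exact: dfc.
move=> e e0; pose c : CC R := `|f x|.
have c0 : 0 < c by rewrite normr_gt0.
(* [k] bounds the differential and the 1 the remainder, so the relative increment of f is at most M
   |h|. *)
pose M : CC R := (k + 1) / c.
have M0 : 0 < M by rewrite divr_gt0 // addr_gt0.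
have [e2 e20 [e2half e2M]] := small_half_multiple e0 M0.
have u_cvg : (L (h + x) - L x) @[h --> (0 : V)] --> (0 : CC R).
  rewrite -(subrr (L x)); apply: cvgB; last exact: cvg_cst.
  by rewrite -[X in _ --> X]/(L x) (cvg_comp_shift x 0 L) add0r.
have Hu : \forall h \near (0 : V), `|cexp (L (h + x) - L x) - 1 -
    (L (h + x) - L x)| <= e2 * `|L (h + x) - L x|.
  exact: u_cvg _ (cexp_near0 e20).
have ec0 : 0 < e / 2 * c by rewrite mulr_gt0 // divr_gt0.
have Hf := is_diff_approx fdf ec0.
have Hf1 := is_diff_approx fdf ltr01.
have Lfx : cexp (L x) = f x := nbhs_singleton Lf.
move: Lf; rewrite (near_shift 0) => Lf.
have HuL := @filterI _ _ (nbhs_filter (0 : V)) _ _ Hu Lf.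
have Hff := @filterI _ _ (nbhs_filter (0 : V)) _ _ Hf Hf1.
apply: (@filterS2 V (nbhs (0 : V)) (nbhs_filter (0 : V)) _ _ _ _ HuL Hff) => h [+ +] [].
rewrite /= subr0; set u := L (h + x) - L x; set d := f (h + x) - f x.
move=> Hcu cLf Hd Hd1.
have cuE : cexp u - 1 = (f x)^-1 * d.
  rewrite /u /d cexpD cexpN cLf Lfx mulrBr mulVf // mulrC //.
rewrite cuE in Hcu.
set a := (f x)^-1 * d in cuE Hcu.
have aM : `|a| <= M * `|h|.
  rewrite /a normrM normfV mulrC /M mulrAC ler_wpM2r ?invr_ge0 ?(ltW c0) //.
  rewrite -[d](subrK ('d f x h)); apply: le_trans (ler_normD _ _) _.
  by rewrite mulrDl addrC lerD.
have al : `|a - (f x)^-1 * 'd f x h| <= e / 2 * `|h|.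
  rewrite /a -mulrBr normrM normfV ler_pdivrMl //.
  by rewrite mulrA [c * _]mulrC.
(* |u - a| <= e2 |u| <= |u| / 2 forces |u| <= 2 |a|. *)
have uM : `|u| <= 2 * M * `|h|.
  rewrite -mulrA -ler_pdivrMl //.
  apply: le_trans aM; rewrite -(lerD2r (e2 * `|u|)).
  apply: (@le_trans _ _ `|u|).
    rewrite [leRHS](_ : _ = 2^-1 * `|u| + 2^-1 * `|u|); last first.
      by rewrite -mulrDl -[2^-1]mul1r -splitr mul1r.
    by rewrite lerD2l ler_wpM2r.
  rewrite -[in leLHS](subrK a u) addrC; apply: le_trans (ler_normD _ _) _.
  by rewrite lerD2l distrC.
rewrite -[u](subrK a) -addrA; apply: le_trans (ler_normD _ _) _.
rewrite (splitr e) mulrDl lerD //.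
rewrite distrC; apply: le_trans Hcu _.
apply: le_trans (ler_wpM2l (ltW e20) uM) _.
by rewrite mulrA ler_wpM2r.
Qed.

(** * Vanishing of forms at solutions, and consequences of balance *)

Section TermAlgebra.
Context {R : realType} {r : nat}.
Implicit Types (t : hyp_term R r) (w : 'rV[CC R]_r).

Lemma dehom0 (F : pzRingType) (w : 'rV[F]_r) : dehom 0 w = 0.
Proof.
by rewrite /dehom /vcoef mxE add0r big1 // => i _; rewrite mxE mul0r.
Qed.

(** If v_i(A_j) were nonzero for some i > 0, the factor 0 ^ m with m nonzero would turn equation i
    into 0 = 1. All these coefficients being zero, v_0(A_j) equals the value at w. *)
Lemma variational_solution_form t w : variational_solutions t w ->
  forall j, dehom (tA t j) w = 0 -> (forall i, teps t i != 0) -> tA t j = 0.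
Proof.
move=> Xw j Aj0 eps0.
have vi0 i : vcoef (lift ord0 i) (tA t j) = 0.
  apply/eqP/negPn/negP => v0; have := Xw i.
  rewrite (bigD1 j) //= Aj0 exp0rz mulf_eq0 (negPf v0) (negPf (eps0 j)) /=.
  by rewrite mul0r mulr0 => /esym/eqP; rewrite oner_eq0.
apply/rowP => i; rewrite mxE; case: (unliftP ord0 i) => [k|] ->; first exact: vi0.
move: Aj0; rewrite /dehom big1 ?addr0 => [/eqP|k _]; last by rewrite vi0 mul0r.
by rewrite intr_eq0 => /eqP.
Qed.

Lemma balanced_eps_neq0 t : balanced t -> forall j, teps t j != 0.
Proof. by case=> _ _ eps1 _ j; case: (eps1 j) => ->. Qed.

Lemma variational_notin_arrangement t w : balanced t ->
  variational_solutions t w -> (~` arrangement t) w.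
Proof.
move=> bal Xw [j Aj0 Ajw]; move/eqP: Aj0; apply.
exact: variational_solution_form Xw _ Ajw (balanced_eps_neq0 bal).
Qed.

Lemma balanced_coef t : balanced t ->
  forall i, \sum_j teps t j * vcoef i (tA t j) = 0.
Proof.
case=> _ _ _ bal i; have := congr1 (fun A : 'rV_ _ => A 0 i) bal.
by rewrite summxE mxE => E; rewrite -[RHS]E; apply: eq_bigr => j _; rewrite mxE.
Qed.

Lemma balanced_dehom t (F : comPzRingType) (w : 'rV[F]_r) : balanced t ->
  \sum_j (teps t j)%:~R * dehom (tA t j) w = 0.
Proof.
move=> bal.
transitivity (\sum_j ((teps t j * vcoef ord0 (tA t j))%:~R +
    \sum_(i < r) (teps t j * vcoef (lift ord0 i) (tA t j))%:~R * w 0 i)).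
  apply: eq_bigr => j _; rewrite /dehom mulrDr mulr_sumr -intrM; congr (_ + _).
  by apply: eq_bigr => i _; rewrite mulrA -intrM.
rewrite big_split /= -(rmorph_sum (intmul 1)) balanced_coef // add0r exchange_big /=.
rewrite big1 // => i _.
by rewrite -mulr_suml -(rmorph_sum (intmul 1)) balanced_coef // mul0r.
Qed.

End TermAlgebra.

(** * The differential of the lifted potential *)

Section CriticalPoints.
Context {R : realType} {r : nat}.
Variable t : hyp_term R r.
Hypothesis bal : balanced t.

(** The partial derivative of the potential along w_i, with the contribution sum_j eps_j v_i(A_j) of
    the logarithms already removed by balance. *)
Definition potential_gradient (lC : 'I_r.+1 -> CC R) (la : 'I_(tJ t) -> CC R)
    (i : 'I_r) : CC R :=
  lC (lift ord0 i) +
  \sum_j (teps t j * vcoef (lift ord0 i) (tA t j))%:~R * la j.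

(** The forms being affine in w, the terms can be collected by w_i. At a critical point only the
    part belonging to n survives. *)
Lemma potential_euler lC la w : potential t lC la w =
  lC ord0 + \sum_j (teps t j * vcoef ord0 (tA t j))%:~R * la j +
  \sum_i w 0 i * potential_gradient lC la i.
Proof.
rewrite /potential /potential_gradient -!addrA; congr (_ + _).
under [X in _ = _ + X]eq_bigr do rewrite mulrDr.
rewrite big_split /= addrCA; congr (_ + _).
under [X in _ = _ + X]eq_bigr do rewrite mulr_sumr.
rewrite exchange_big /= -big_split /=; apply: eq_bigr => j _.
rewrite /dehom mulrDr mulrDl -intrM; congr (_ + _).
rewrite mulr_sumr mulr_suml; apply: eq_bigr => i _.
by rewrite [in RHS]mulrA mulrA -intrM [w 0 i * _]mulrC.
Qed.

Lemma is_diff_dehom (A : 'rV[int]_r.+1) (x : 'rV[CC R]_r) :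
  is_diff x (fun w : 'rV[CC R]_r => dehom A w : CC R)
    (fun h : 'rV[CC R]_r =>
       \sum_(i < r) (vcoef (lift ord0 i) A)%:~R * h 0 i : CC R).
Proof.
pose f (i : 'I_r) (w : 'rV[CC R]_r) : CC R := (vcoef (lift ord0 i) A)%:~R * w 0 i.
have fd i : is_diff x (f i) (f i).
  exact: (@is_diffZ _ _ _ _ _ ((vcoef (lift ord0 i) A)%:~R : CC R) x
    (is_diff_coord x i)).
have := @is_diffD _ _ _ _ _ _ _ _
  (is_diff_cst ((vcoef ord0 A)%:~R : CC R) x) (is_diff_sum fd).
by rewrite add0r.
Qed.

Variables (E : topologicalType) (p : E -> 'rV[CC R]_r).
Variable lA : 'I_(tJ t) -> E -> CC R.
Hypothesis lAb : log_branches t p lA.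

Lemma is_diff_lifted_potential (lC : 'I_r.+1 -> CC R) (e : E)
    (s : 'rV[CC R]_r -> E) :
  ~ arrangement t (p e) -> s (p e) = e -> {for p e, continuous s} ->
  (\forall w \near p e, p (s w) = w) ->
  is_diff (p e) (lifted_potential t p lC lA \o s)
    (fun h : 'rV[CC R]_r =>
       \sum_i potential_gradient lC (lA ^~ e) i * h 0 i).
Proof.
move=> arr se sc ps; set x := p e in arr se sc ps *.
pose F (j : 'I_(tJ t)) (w : 'rV[CC R]_r) : CC R :=
  dehom (tA t j) w * lA j (s w).
pose dA (j : 'I_(tJ t)) (h : 'rV[CC R]_r) : CC R :=
  \sum_(i < r) (vcoef (lift ord0 i) (tA t j))%:~R * h 0 i.
have dF j : is_diff x (F j) (fun h => dA j h + lA j e * dA j h).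
  (* Branches over a zero form are arbitrary, but there both [F j] and [dA j] vanish. *)
  have [A0|A0] := eqVneq (tA t j) 0.
    have -> : F j = cst 0.
      by apply/funext => w; rewrite /F A0 dehom0 mul0r.
    rewrite (_ : (fun h => _) = 0); first exact: is_diff_cst.
    apply/funext => h; rewrite /dA A0 big1 ?mulr0 ?addr0 // => i _.
    by rewrite /vcoef mxE mul0r.
  have Ax0 : dehom (tA t j) x != 0.
    by apply/eqP => Ax; apply: arr; exists j.
  have dAx := is_diff_dehom (tA t j) x.
  have Lc : {for x, continuous (lA j \o s)}.
    apply: continuous_comp; first exact: sc.
    exact: (lAb j).1.
  have Ac : {for x, continuous (fun w : 'rV[CC R]_r => dehom (tA t j) w : CC R)}.
    exact: differentiable_continuous (@ex_diff _ _ _ _ _ _ _ dAx).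
  have An0 : \forall w \near x, dehom (tA t j) w != 0.
    exact: cvgr_neq0 Ac Ax0.
  have cL : \forall w \near x, cexp ((lA j \o s) w) = dehom (tA t j) w.
    have H := @filterI _ _ (nbhs_filter x) _ _ ps An0.
    apply: (@filterS _ _ (nbhs_filter x) _ _ _ H) => w /= [psw Aw].
    by rewrite (lAb j).2 psw.
  have dL := is_diff_log dAx Ax0 Lc cL.
  have := is_diffM dAx dL; rewrite /= se => H; apply: is_diff_eq H _.
  apply/funext => h; rewrite -[LHS]/(dehom (tA t j) x *
    ((dehom (tA t j) x)^-1 * dA j h) + lA j e * dA j h).
  by rewrite mulrA mulfV // mul1r.
pose c (i : 'I_r) (w : 'rV[CC R]_r) : CC R := lC (lift ord0 i) * w 0 i.
have dc i : is_diff x (c i) (c i).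
  exact: (@is_diffZ _ _ _ _ _ (lC (lift ord0 i)) x (is_diff_coord x i)).
have deF j : is_diff x ((teps t j)%:~R *: F j)
    ((teps t j)%:~R *: fun h => dA j h + lA j e * dA j h).
  exact: (@is_diffZ _ _ _ _ _ ((teps t j)%:~R : CC R) x (dF j)).
have dG := @is_diffD _ _ _ _ _ _ _ _
  (@is_diffD _ _ _ _ _ _ _ _ (is_diff_cst (lC ord0) x) (is_diff_sum dc))
  (is_diff_sum deF).
apply: (@near_eq_is_diff _ _ _ _ _ _ _ _ (is_diff_eq dG _)).
  apply: (@filterS _ _ (nbhs_filter x) _ _ _ ps) => w psw /=.
  rewrite /lifted_potential /potential psw.
  rewrite -[RHS]/(lC ord0 + \sum_i c i w + \sum_j (teps t j)%:~R * F j w).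
  congr (_ + _ + _); first by apply: eq_bigr => i _; rewrite mulrC.
  by apply: eq_bigr => j _; rewrite -mulrA.
apply/funext => h; rewrite -[LHS]/(0 + \sum_i c i h +
  \sum_j (teps t j)%:~R * (dA j h + lA j e * dA j h)).
rewrite add0r /potential_gradient.
under [RHS]eq_bigr do rewrite mulrDl.
rewrite big_split /=; congr (_ + _).
under eq_bigr do rewrite mulrDr; rewrite big_split /=.
(* The terms eps_j dA_j, coming from the differentials of the logarithms, cancel by balance. *)
rewrite (_ : \sum_j _ * dA j h = 0) ?add0r.
  under [RHS]eq_bigr do rewrite mulr_suml.
  rewrite exchange_big /=; apply: eq_bigr => j _.
  rewrite mulrA mulr_sumr; apply: eq_bigr => i _.
  by rewrite intrM !mulrA; congr (_ * _); rewrite mulrAC.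
transitivity (\sum_j \sum_i
    (teps t j * vcoef (lift ord0 i) (tA t j))%:~R * h 0 i : CC R).
  apply: eq_bigr => j _; rewrite mulr_sumr; apply: eq_bigr => i _.
  by rewrite mulrA -intrM.
rewrite exchange_big big1 //= => i _.
by rewrite -mulr_suml -(rmorph_sum (intmul 1)) balanced_coef // mul0r.
Qed.

(** Differentials are unique, so a zero differential has zero coefficients. Conversely, a sheet of
    the covering through e supplies the local section. *)
Lemma critical_pointP (lC : 'I_r.+1 -> CC R) (e : E) :
  covering_map (~` arrangement t) p ->
  critical_point p (lifted_potential t p lC lA) e <->
  forall i, potential_gradient lC (lA ^~ e) i = 0.
Proof.
case=> pc prange pcov.
have arr : ~ arrangement t (p e).
  by have : range p (p e) by []; rewrite prange.
split=> [[s [se sc ps sd]] i|g0].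
  have /(_ arr se sc ps) d := @is_diff_lifted_potential lC e s.
  have /(congr1 (@^~ (delta_mx 0 i))) /= := is_diff_unique sd d.
  rewrite (bigD1 i) //= !mxE !eqxx mulr1 big1 ?addr0 // => k ki.
  by rewrite mxE eqxx (negPf ki) mulr0.
have [U [I [s [Uo Ue UB [sc ps so eU]]]]] := pcov _ arr.
have [i [si _]] := eU e Ue.
have nU : nbhs (p e) U by apply: open_nbhs_nbhs.
have psn : \forall w \near p e, p (s i w) = w.
  by apply: (@filterS _ _ (nbhs_filter (p e)) _ _ _ nU) => w; exact: ps.
exists (s i); split; [exact: si | exact: sc | exact: psn |].
apply: is_diff_eq (is_diff_lifted_potential lC arr si (sc _ _ Ue) psn) _.
by apply/funext => h; rewrite big1 // => k _; rewrite g0 mul0r.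
Qed.

(** Over a zero form the values of [lA j] are not logarithms of anything, hence the condition that
    its multiplicity be 0. *)
Lemma cexp_log_branch (e : E) (m : 'I_(tJ t) -> int) :
  ~ arrangement t (p e) -> (forall j, tA t j = 0 -> m j = 0) ->
  cexp (\sum_j (m j)%:~R * lA j e) = \prod_j dehom (tA t j) (p e) ^ m j.
Proof.
move=> arr m0; rewrite cexp_sum; apply: eq_bigr => j _; rewrite cexpMz.
have [A0|A0] := eqVneq (tA t j) 0; first by rewrite m0 // !expr0z.
by rewrite (lAb j).2 //; apply/eqP => Ax; apply: arr; exists j.
Qed.

Lemma cexp_gradient (lC : 'I_r.+1 -> CC R) (e : E) (i : 'I_r) :
  ~ arrangement t (p e) -> log_constants t lC ->
  cexp (potential_gradient lC (lA ^~ e) i) = tC t (lift ord0 i) *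
    \prod_j dehom (tA t j) (p e) ^ (teps t j * vcoef (lift ord0 i) (tA t j)).
Proof.
move=> arr lCt; rewrite cexpD lCt cexp_log_branch // => j ->.
by rewrite /vcoef mxE mulr0.
Qed.

Lemma cexp_critical_value (lC : 'I_r.+1 -> CC R) (e : E) :
  ~ arrangement t (p e) -> log_constants t lC ->
  (forall i, potential_gradient lC (lA ^~ e) i = 0) ->
  cexp (- lifted_potential t p lC lA e) = (tC t ord0)^-1 *
    \prod_j dehom (tA t j) (p e) ^ (- (teps t j * vcoef ord0 (tA t j))).
Proof.
move=> arr lCt g0; rewrite /lifted_potential potential_euler.
rewrite [X in _ + X]big1 ?addr0; last by move=> i _; rewrite g0 mulr0.
rewrite opprD cexpD cexpN lCt; congr (_ * _).
rewrite -sumrN -cexp_log_branch // => [|j ->]; last by rewrite /vcoef mxE mulr0 oppr0.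
by congr cexp; apply: eq_bigr => j _; rewrite intrN mulNr.
Qed.

End CriticalPoints.

(** Off the arrangement only zero forms vanish, and their exponent is 0. *)
Lemma prod_dehom_neq0 (R : realType) (r : nat) (t : hyp_term R r)
    (w : 'rV[CC R]_r) : ~ arrangement t w ->
  \prod_j dehom (tA t j) w ^ (- (teps t j * vcoef ord0 (tA t j))) =
  \prod_(j | dehom (tA t j) w != 0)
    dehom (tA t j) w ^ (- (teps t j * vcoef ord0 (tA t j))).
Proof.
move=> arr; rewrite [RHS]big_mkcond; apply: eq_bigr => j _.
case: eqP => //= Aw; have -> : tA t j = 0.
  by apply/eqP/negPn/negP => A0; apply: arr; exists j.
by rewrite /vcoef mxE mulr0 oppr0 expr0z.
Qed.

(** * Critical points over the variational solutions, and their critical values *)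

Section CriticalSet.
Context {R : realType} {r : nat} {t : hyp_term R r}.
Hypothesis bal : balanced t.
Context {E : topologicalType} {p : E -> 'rV[CC R]_r}.
Hypothesis pcov : covering_map (~` arrangement t) p.
Context {lA : 'I_(tJ t) -> E -> CC R}.
Hypothesis lAb : log_branches t p lA.

Let arr e : ~ arrangement t (p e).
Proof.
by case: pcov => _ prange _; have : range p (p e) by []; rewrite prange.
Qed.

Lemma variational_critical :
  p @^-1` variational_solutions t =
    [set e | exists2 lC, log_constants t lC &
               critical_point p (lifted_potential t p lC lA) e].
Proof.
apply/seteqP; split=> e /=; last first.
  move=> [lC lCt /(critical_pointP bal lAb)-/(_ pcov) g0] i.
  by rewrite -(cexp_gradient lAb i (@arr e) lCt) g0 cexp0.
move=> Xe.
have [l0 l0E] := cexp_surj (let: And4 C0 _ _ _ := bal in C0 ord0).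
(* log C_0 is arbitrary, while log C_i is chosen to annihilate the i-th partial derivative; the
   variational equation says that this choice is a logarithm of C_i. *)
pose lC k := if unlift ord0 k is Some i then
  - \sum_j (teps t j * vcoef (lift ord0 i) (tA t j))%:~R * lA j e else l0.
have lCt : log_constants t lC.
  move=> k; rewrite /lC; case: unliftP => [i ->|->] //.
  rewrite cexpN (cexp_log_branch lAb (@arr e)) => [|j ->]; last first.
    by rewrite /vcoef mxE mulr0.
  have Xi := Xe i.
  have q0 : \prod_j dehom (tA t j) (p e) ^
      (teps t j * vcoef (lift ord0 i) (tA t j)) != 0.
    by apply: contra_eq_neq Xi => ->; rewrite mulr0 eq_sym oner_eq0.
  by rewrite -[RHS](mulfK q0) Xi mul1r.
exists lC => //; apply/(critical_pointP bal lAb) => // i.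
by rewrite /potential_gradient /lC liftK addNr.
Qed.

Lemma critical_value_formula lC e : log_constants t lC ->
  critical_point p (lifted_potential t p lC lA) e ->
  cexp (- lifted_potential t p lC lA e) = (tC t ord0)^-1 *
    \prod_j dehom (tA t j) (p e) ^ (- (teps t j * vcoef ord0 (tA t j))).
Proof.
move=> lCt /(critical_pointP bal lAb)-/(_ pcov).
exact: cexp_critical_value (@arr e) lCt.
Qed.

Lemma CV_critical_values :
  CV t = [set z | exists lC e,
    [/\ log_constants t lC, critical_point p (lifted_potential t p lC lA) e &
        z = cexp (- lifted_potential t p lC lA e)]].
Proof.
have CrX e : (p @^-1` variational_solutions t) e <->
    exists2 lC, log_constants t lC & critical_point p (lifted_potential t p lC lA) e.
  by rewrite variational_critical.
apply/seteqP; split=> z /=.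
  move=> [w Xw <-].
  (* Solutions avoid the arrangement, so each of them lifts to the cover. *)
  have /= [e _ pe] : range p w.
    by case: pcov => _ -> _; exact: variational_notin_arrangement.
  have [|lC lCt cr] := (CrX e).1; first by rewrite /= pe.
  exists lC, e; split=> //.
  rewrite -pe (critical_value_formula lCt cr); congr (_ * _).
  exact: esym (prod_dehom_neq0 (@arr e)).
move=> [lC [e [lCt cr ->]]]; exists (p e); first by apply/CrX; exists lC.
by rewrite (critical_value_formula lCt cr) (prod_dehom_neq0 (@arr e)).
Qed.

End CriticalSet.

(** * Integral forms pulled back along a face parametrization *)

Section Restriction.
Context {r s : nat} (phi : 'M[int]_(s.+1, r.+1)).

Lemma dehom_mulmx (F : comPzRingType) (A : 'rV[int]_r.+1) (w : 'rV[F]_s) :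
  dehom (A *m phi^T) w = \sum_i (A 0 i)%:~R * dehom (col i phi)^T w.
Proof.
rewrite /dehom /vcoef mxE rmorph_sum /=.
under eq_bigr do rewrite mxE intrM.
under [X in _ + X]eq_bigr do rewrite mxE rmorph_sum /= mulr_suml.
rewrite exchange_big -big_split /=; apply: eq_bigr => i _.
rewrite !mxE mulrDr mulr_sumr; congr (_ + _); apply: eq_bigr => l _.
by rewrite !mxE intrM mulrA.
Qed.

Hypothesis phi_l0 : forall l : 'I_s, phi (lift ord0 l) ord0 = 0.

Lemma dehom_col0 (F : pzRingType) (w : 'rV[F]_s) :
  dehom (col ord0 phi)^T w = (phi ord0 ord0)%:~R.
Proof.
rewrite /dehom /vcoef !mxE big1 ?addr0 // => l _.
by rewrite !mxE phi_l0 mul0r.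
Qed.

Context {F : fieldType}.
Hypothesis d0 : (phi ord0 ord0)%:~R != 0 :> F.

Lemma dehom_col_affine (w : 'rV[F]_s) (i : 'I_r) :
  dehom (col (lift ord0 i) phi)^T w =
  (phi ord0 ord0)%:~R * affine_param phi w 0 i.
Proof. by rewrite mxE mulrC divfK. Qed.

(** The first column of phi is d = [phi ord0 ord0] followed by zeros, so the image of (1, w) is d
    times the homogenization of [affine_param phi w]. *)
Lemma dehom_restrict (A : 'rV[int]_r.+1) (w : 'rV[F]_s) :
  dehom (A *m phi^T) w =
  (phi ord0 ord0)%:~R * dehom A (affine_param phi w).
Proof.
rewrite dehom_mulmx big_ord_recl dehom_col0 [dehom A _]/dehom mulrDr mulrC.
congr (_ + _).
rewrite mulr_sumr; apply: eq_bigr => i _.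
by rewrite dehom_col_affine mulrCA.
Qed.

End Restriction.

(** * The restricted potential and its branches *)

Section RestrictPotential.
Context {R : realType} {r s : nat} (t : hyp_term R r).
Context (phi : 'M[int]_(s.+1, r.+1)).
Hypothesis bal : balanced t.
Hypothesis phi00 : 0 < phi ord0 ord0.
Hypothesis phi_l0 : forall l : 'I_s, phi (lift ord0 l) ord0 = 0.

Let d0 : (phi ord0 ord0)%:~R != 0 :> CC R.
Proof. by rewrite intr_eq0 gt_eqF. Qed.

Lemma restrict_log_constants lC : log_constants t lC ->
  log_constants (restrict_term t phi) (restrict_logs phi lC).
Proof.
move=> lCt l; rewrite /restrict_logs cexp_sum /=.
by apply: eq_bigr => i _; rewrite cexpMz lCt.
Qed.

(** Adding one constant c to all logarithms costs c times the signed sum of the forms, which is 0 by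
    balance. This allows log (d A_j) to be traded for log A_j. *)
Lemma potential_restrict (lC : 'I_r.+1 -> CC R) (la : 'I_(tJ t) -> CC R)
    (c : CC R) (w : 'rV[CC R]_s) :
  potential (restrict_term t phi) (restrict_logs phi lC) (fun j => la j + c) w =
  (phi ord0 ord0)%:~R * potential t lC la (affine_param phi w).
Proof.
rewrite /potential mulrDr; congr (_ + _).
  transitivity (\sum_i dehom (col i phi)^T w * lC i).
    rewrite /restrict_logs; under [X in _ + X]eq_bigr do rewrite mulr_sumr.
    rewrite exchange_big -big_split /=; apply: eq_bigr => i _.
    rewrite /dehom /vcoef mulrDl mulr_suml !mxE; congr (_ + _).
    by apply: eq_bigr => l _; rewrite !mxE mulrCA mulrA.
  rewrite big_ord_recl dehom_col0 // mulrDr; congr (_ + _).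
  rewrite mulr_sumr; apply: eq_bigr => i _.
  by rewrite dehom_col_affine // mulrA.
under eq_bigr do rewrite mulrDr.
rewrite big_split /= -mulr_suml.
have /(balanced_dehom w) /= -> := balanced_restrict phi bal.
rewrite mul0r addr0 mulr_sumr; apply: eq_bigr => j _.
by rewrite dehom_restrict // !mulrA [_%:~R * _%:~R]mulrC.
Qed.

Lemma potential_branches_restrict (E : topologicalType) (p : E -> 'rV[CC R]_s) lC :
  potential_branches (restrict_term t phi) p (restrict_logs phi lC) =
  [set (fun e => (phi ord0 ord0)%:~R * V e)
    | V in potential_branches t (affine_param phi \o p) lC].
Proof.
(* The restricted forms are d times the original ones, so a shift by c = log d exchanges their
   branches. *)
have [c cE] := cexp_surj d0.
have aE A e : dehom (A *m phi^T) (p e) =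
    (phi ord0 ord0)%:~R * dehom A (affine_param phi (p e)).
  exact: dehom_restrict.
apply/seteqP; split=> V /=.
  move=> [lA lAb <-].
  exists (lifted_potential t (affine_param phi \o p) lC (fun j e => lA j e - c)).
    exists (fun j e => lA j e - c) => // j; have [lAc lAE] := lAb j; split.
      by move=> e; apply: cvgB; [exact: lAc | exact: cvg_cst].
    move=> e /= Ae; rewrite cexpD cexpN cE lAE /=; last by rewrite aE mulf_neq0.
    by rewrite aE mulrC mulKf.
  apply/funext => e; rewrite /lifted_potential -(potential_restrict _ _ c) /=.
  by congr potential; apply/funext => j; rewrite subrK.
move=> [_ [lA lAb <-] <-]; exists (fun j e => lA j e + c); last first.
  by apply/funext => e; rewrite /lifted_potential potential_restrict.
move=> j; have [lAc lAE] := lAb j; split.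
  by move=> e; apply: cvgD; [exact: lAc | exact: cvg_cst].
move=> e /=; rewrite aE mulf_eq0 negb_or => /andP[_ Ae].
by rewrite cexpD lAE // cE mulrC.
Qed.

End RestrictPotential.

(** * Subfields given as sets, and polynomials over them *)

Section Subfield.
Context {L : fieldType} {K : set L}.
Hypothesis Ksub : is_subfield K.

Lemma subfield1 : K 1. Proof. by case: Ksub. Qed.
Lemma subfieldB x y : K x -> K y -> K (x - y).
Proof. by case: Ksub => _ + _; apply. Qed.
Lemma subfield_div x y : K x -> K y -> K (x / y).
Proof. by case: Ksub => _ _; apply. Qed.
Lemma subfield0 : K 0.
Proof. by rewrite -(subrr 1); apply: subfieldB; exact: subfield1. Qed.
Lemma subfieldN x : K x -> K (- x).
Proof. by rewrite -sub0r; exact/subfieldB/subfield0. Qed.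
Lemma subfieldD x y : K x -> K y -> K (x + y).
Proof. by move=> Kx Ky; rewrite -[y]opprK; apply/subfieldB/subfieldN. Qed.
Lemma subfieldV x : K x -> K x^-1.
Proof. by rewrite -div1r; exact/subfield_div/subfield1. Qed.
Lemma subfieldM x y : K x -> K y -> K (x * y).
Proof. by move=> Kx Ky; rewrite -[y]invrK; apply/subfield_div/subfieldV. Qed.
Lemma subfield_sum (I : Type) (s : seq I) (P : pred I) (F : I -> L) :
  (forall i, K (F i)) -> K (\sum_(i <- s | P i) F i).
Proof. by move=> KF; apply: big_ind => //; [exact: subfield0 | exact: subfieldD]. Qed.
Lemma subfieldMn x n : K x -> K (x *+ n).
Proof.
move=> Kx; elim: n => [|n IHn]; first exact: subfield0.
by rewrite mulrS; exact: subfieldD.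
Qed.
Lemma subfieldMz x m : K x -> K (x *~ m).
Proof. by case: m => n Kx; [|apply: subfieldN]; exact: subfieldMn. Qed.

Lemma subfieldX x n : K x -> K (x ^+ n).
Proof.
move=> Kx; elim: n => [|n IHn]; first exact: subfield1.
by rewrite exprS; exact: subfieldM.
Qed.

Lemma subfieldXz x m : K x -> K (x ^ m).
Proof.
move=> Kx; case: m => n; first exact: subfieldX.
by rewrite NegzE -exprnN; exact/subfieldV/subfieldX.
Qed.

Definition coefs_in (p : {poly L}) := forall i, K p`_i.

Lemma coefs_inC c : K c -> coefs_in c%:P.
Proof. by move=> Kc i; rewrite coefC; case: eqP => // _; exact: subfield0. Qed.
Lemma coefs_inX : coefs_in 'X.
Proof.
move=> i; rewrite coefX.
by case: eqP => _; [exact: subfield1 | exact: subfield0].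
Qed.
Lemma coefs_in1 : coefs_in 1.
Proof. exact/coefs_inC/subfield1. Qed.
Lemma coefs_in0 : coefs_in 0.
Proof. exact/coefs_inC/subfield0. Qed.
Lemma coefs_inD p q : coefs_in p -> coefs_in q -> coefs_in (p + q).
Proof. by move=> Kp Kq i; rewrite coefD; exact: subfieldD. Qed.
Lemma coefs_inB p q : coefs_in p -> coefs_in q -> coefs_in (p - q).
Proof. by move=> Kp Kq i; rewrite coefB; exact: subfieldB. Qed.
Lemma coefs_inM p q : coefs_in p -> coefs_in q -> coefs_in (p * q).
Proof.
by move=> Kp Kq i; rewrite coefM; apply: subfield_sum => j; exact: subfieldM.
Qed.
Lemma coefs_inXn n : coefs_in 'X^n.
Proof.
elim: n => [|n IHn]; first exact: coefs_in1.
by rewrite exprS; apply: coefs_inM => //; exact: coefs_inX.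
Qed.
Lemma coefs_in_deriv p : coefs_in p -> coefs_in p^`().
Proof. by move=> Kp i; rewrite coef_deriv; exact: subfieldMn. Qed.

End Subfield.

(** * Derivations on a subfield and their extension by one element *)

Definition derivation_on (L : fieldType) (K : set L) (D : L -> L) : Prop :=
  [/\ is_subfield K, forall x y, K x -> K y -> D (x + y) = D x + D y &
      forall x y, K x -> K y -> D (x * y) = D x * y + x * D y].

Section DerivationTheory.
Context {L : fieldType} {K : set L} {D : L -> L}.
Hypothesis derKD : derivation_on K D.

Let Ksub : is_subfield K. Proof. by case: derKD. Qed.

Lemma derivationD x y : K x -> K y -> D (x + y) = D x + D y.
Proof. by case: derKD => _ + _; apply. Qed.
Lemma derivationM x y : K x -> K y -> D (x * y) = D x * y + x * D y.
Proof. by case: derKD => _ _; apply. Qed.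
Lemma derivation0 : D 0 = 0.
Proof.
have K0 := subfield0 Ksub; have := derivationD K0 K0.
by rewrite addr0 => /eqP; rewrite -subr_eq0 opprD addrA subrr sub0r oppr_eq0 => /eqP.
Qed.
Lemma derivation1 : D 1 = 0.
Proof.
have K1 := subfield1 Ksub; have := derivationM K1 K1.
rewrite !mulr1 mul1r => /eqP.
by rewrite -subr_eq0 opprD addrA subrr sub0r oppr_eq0 => /eqP.
Qed.
Lemma derivationN x : K x -> D (- x) = - D x.
Proof.
move=> Kx; apply/eqP; rewrite -subr_eq0 opprK -derivationD ?addNr ?derivation0 //.
exact: subfieldN.
Qed.
Lemma derivation_sum (I : Type) (s : seq I) (F : I -> L) : (forall i, K (F i)) ->
  D (\sum_(i <- s) F i) = \sum_(i <- s) D (F i).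
Proof.
move=> KF; elim: s => [|i s IHs]; first by rewrite !big_nil derivation0.
by rewrite !big_cons derivationD ?IHs //; exact: subfield_sum.
Qed.
Lemma derivationMz x m : K x -> D (x *~ m) = D x *~ m.
Proof.
move=> Kx.
have nat_case n : D (x *+ n) = D x *+ n.
  elim: n => [|n IHn]; first by rewrite !mulr0n derivation0.
  by rewrite !mulrS derivationD ?IHn //; exact: subfieldMn.
case: m => n; first exact: nat_case.
by rewrite NegzE !mulrNz -!pmulrn derivationN ?nat_case //; exact: subfieldMn.
Qed.

Lemma map_derivM p q : coefs_in (K := K) p -> coefs_in (K := K) q ->
  map_poly D (p * q) = map_poly D p * q + p * map_poly D q.
Proof.
move=> Kp Kq; apply/polyP => n.
rewrite coefD !coefM coef_map_id0 ?derivation0 // coefM derivation_sum; last first.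
  by move=> i; exact: subfieldM.
rewrite -big_split /=; apply: eq_bigr => i _.
by rewrite !coef_map_id0 ?derivation0 // derivationM.
Qed.

Lemma map_derivD p q : coefs_in (K := K) p -> coefs_in (K := K) q ->
  map_poly D (p + q) = map_poly D p + map_poly D q.
Proof.
move=> Kp Kq; apply/polyP => n.
by rewrite coefD !coef_map_id0 ?derivation0 // coefD derivationD.
Qed.

Variables x x' : L.

(* The value at x of the derivative of p, if x is given the derivative x'. *)
Definition jet (p : {poly L}) : L := (map_poly D p).[x] + p^`().[x] * x'.

Lemma jetD p q : coefs_in (K := K) p -> coefs_in (K := K) q ->
  jet (p + q) = jet p + jet q.
Proof.
by move=> Kp Kq; rewrite /jet map_derivD // derivD !hornerD mulrDl addrACA.
Qed.
Lemma jetM p q : coefs_in (K := K) p -> coefs_in (K := K) q ->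
  jet (p * q) = jet p * q.[x] + p.[x] * jet q.
Proof.
by move=> Kp Kq; rewrite /jet map_derivM // derivM !hornerD !hornerM; ring.
Qed.
Lemma jetC c : jet c%:P = D c.
Proof.
rewrite /jet derivC horner0 mul0r addr0 -[in LHS]alg_polyC.
by rewrite (_ : map_poly D _ = (D c)%:P) ?hornerC //; apply/polyP => i;
  rewrite coef_map_id0 ?derivation0 // alg_polyC !coefC; case: eqP; rewrite ?derivation0.
Qed.
Lemma jetX : jet 'X = x'.
Proof.
rewrite /jet derivX hornerC mul1r (_ : map_poly D 'X = 0) ?horner0 ?add0r //.
apply/polyP => i; rewrite coef_map_id0 ?derivation0 // coefX coef0.
by case: eqP; rewrite ?derivation0 ?derivation1.
Qed.
Lemma jetB p q : coefs_in (K := K) p -> coefs_in (K := K) q ->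
  jet (p - q) = jet p - jet q.
Proof.
move=> Kp Kq; have Kpq := coefs_inB Ksub Kp Kq.
by apply/eqP; rewrite eq_sym subr_eq -jetD // subrK.
Qed.

Hypothesis jet_root : forall p, coefs_in (K := K) p -> p.[x] = 0 -> jet p = 0.

Let quot_rep y p q :=
  [/\ coefs_in (K := K) p, coefs_in (K := K) q, q.[x] != 0 & y = p.[x] / q.[x]].
Let K1 : set L := [set y | exists p q, quot_rep y p q].
Let dq p q := (jet p * q.[x] - p.[x] * jet q) / q.[x] ^+ 2.

(** If p(x) / q(x) = p1(x) / q1(x), then p q1 - p1 q vanishes at x and so does its jet; this
    relation gives the equality of the two quotient rules. *)
Let dq_unique p q p1 q1 y : quot_rep y p q -> quot_rep y p1 q1 -> dq p q = dq p1 q1.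
Proof.
move=> [Kp Kq q0 ->] [Kp1 Kq1 q10 E].
have E1 : p.[x] * q1.[x] = p1.[x] * q.[x] by apply/eqP; rewrite -eqr_div // E.
have : jet (p * q1 - p1 * q) = 0.
  apply: jet_root; first by apply: coefs_inB => //; exact: coefs_inM.
  by rewrite hornerD hornerN !hornerM E1 subrr.
rewrite jetB ?jetM //; try exact: coefs_inM.
rewrite /dq; move: E1 q0 q10.
move: p.[x] q.[x] p1.[x] q1.[x] (jet p) (jet q) (jet p1) (jet q1).
move=> a b a1 b1 da db da1 db1.
move=> E1 b0 b10 E2.
have Ea : a = a1 * b / b1 by rewrite -E1 mulfK.
have Eda : da = (da1 * b + a1 * db - a * db1) / b1.
  rewrite -[LHS](mulfK b10); congr (_ / _).
  by apply/eqP; rewrite -subr_eq0 -E2; apply/eqP; ring.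
rewrite Eda Ea; field; by rewrite b0 b10.
Qed.

(** On K(x), the set of values p(x) / q(x), the derivation is defined by the quotient rule.
    [jet_root] is the compatibility with the algebraic relations of x that makes it well defined. *)
Lemma extend_derivation : exists K1 D1,
  [/\ derivation_on K1 D1, K `<=` K1, K1 x, D1 x = x' &
      forall y, K y -> D1 y = D y].
Proof.
have /choice[D1 D1E] y : exists d, forall p q, quot_rep y p q -> d = dq p q.
  have [[p [q yr]]|nK] := pselect (K1 y).
    by exists (dq p q) => p1 q1 /(dq_unique yr).
  by exists 0 => p q yr; case: nK; exists p, q.
have c1 := coefs_in1 Ksub; have one0 : (1 : {poly L}).[x] != 0.
  by rewrite hornerC oner_neq0.
have emb y : K y -> quot_rep y y%:P 1.
  by move=> Ky; split=> //; [exact: coefs_inC | rewrite !hornerC divr1].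
have repX : quot_rep x 'X 1.
  by split=> //; [exact: coefs_inX | rewrite hornerX hornerC divr1].
exists K1, D1; split.
- split.
  + split.
    * by exists 1%:P, 1; apply/emb/subfield1.
    * move=> y z [p [q [Kp Kq q0 ->]]] [p1 [q1 [Kp1 Kq1 q10 ->]]].
      exists (p * q1 - p1 * q), (q * q1); split.
      - by apply: coefs_inB => //; exact: coefs_inM.
      - exact: coefs_inM.
      - by rewrite hornerM mulf_neq0.
      - by rewrite hornerD hornerN !hornerM; field; rewrite q0 q10.
    * move=> y z [p [q [Kp Kq q0 ->]]] [p1 [q1 [Kp1 Kq1 q10 ->]]].
      (* Division by zero returns 0, which is represented by 0 / 1. *)
      have [p10|p10] := eqVneq p1.[x] 0.
        exists 0, 1; split=> //; first exact: coefs_in0.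
        by rewrite p10 mul0r invr0 mulr0 horner0 mul0r.
      exists (p * q1), (q * p1); split; try exact: coefs_inM.
        by rewrite hornerM mulf_neq0.
      by rewrite !hornerM; field; rewrite q0 p10 q10.
  + move=> y z [p [q yr]] [p1 [q1 zr]].
    rewrite (D1E _ _ _ yr) (D1E _ _ _ zr).
    case: yr zr => [Kp Kq q0 ->] [Kp1 Kq1 q10 ->].
    rewrite (D1E _ (p * q1 + p1 * q) (q * q1)); last first.
      split; first (apply: coefs_inD => //); try exact: coefs_inM.
        by rewrite hornerM mulf_neq0.
      by rewrite hornerD !hornerM; field; rewrite q0 q10.
    rewrite /dq jetD ?jetM // ?hornerD ?hornerM; try exact: coefs_inM.
    by field; rewrite q0 q10.
  + move=> y z [p [q yr]] [p1 [q1 zr]].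
    rewrite (D1E _ _ _ yr) (D1E _ _ _ zr).
    case: yr zr => [Kp Kq q0 ->] [Kp1 Kq1 q10 ->].
    rewrite (D1E _ (p * p1) (q * q1)); last first.
      split; try exact: coefs_inM.
        by rewrite hornerM mulf_neq0.
      by rewrite !hornerM; field; rewrite q0 q10.
    rewrite /dq !jetM // ?hornerM.
    by field; rewrite q0 q10.
- by move=> y /emb ?; exists y%:P, 1.
- by exists 'X, 1.
- rewrite (D1E _ _ _ repX) /dq jetX jetC derivation1 !hornerC.
  by rewrite mulr0 subr0 expr1n divr1 mulr1.
- move=> y /emb yr; rewrite (D1E _ _ _ yr) /dq !jetC derivation1 !hornerC.
  by rewrite mulr0 subr0 expr1n divr1 mulr1.
Qed.

End DerivationTheory.

(** * Derivations that are nontrivial at a transcendental number *)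

Section DerivationExistence.
Context {L : numFieldType}.
Implicit Types (K : set L) (D : L -> L).

(* At an algebraic x the derivative is forced by the minimal polynomial m of x:
   x' = - m^D(x) / m'(x). *)
Lemma extend_derivation_to K D (x : L) : derivation_on K D ->
  exists K1 D1, [/\ derivation_on K1 D1, K `<=` K1, K1 x &
    forall y, K y -> D1 y = D y].
Proof.
move=> KD; have Ksub : is_subfield K by case: KD.
suff [x' jx] : exists x', forall p, coefs_in (K := K) p -> p.[x] = 0 ->
    jet (D := D) x x' p = 0.
  by have [K1 [D1 [? ? ? _ ?]]] := extend_derivation KD jx; exists K1, D1.
pose ann n := `[< exists p, [/\ coefs_in (K := K) p, p != 0, p.[x] = 0 & size p = n] >].
have [exn|nexn] := pselect (exists n, ann n); last first.
  (* For x transcendental over K the derivative is free, and 0 is chosen. *)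
  exists 0 => p Kp px; have [->|p0] := eqVneq p 0.
    by rewrite -polyC0 (jetC KD) (derivation0 KD).
  by case: nexn; exists (size p); apply/asboolP; exists p.
case: (ex_minnP exn) => n /asboolP[m [Km m0 mx <-]] m_min {n}.
have sm : (1 < size m)%N.
  rewrite ltnNge; apply/negP => /size1_polyC mC; move: m0 mx.
  by rewrite mC hornerC polyC_eq0 => /eqP.
(* In characteristic 0 the derivative of m is nonzero and of smaller degree, so minimality forbids
   it to vanish at x. *)
have dm0 : m^`().[x] != 0.
  apply/eqP => dmx.
  have : (size m <= size m^`())%N.
    apply: m_min; apply/asboolP; exists m^`(); split=> //.
      exact: coefs_in_deriv.
    apply/eqP => /(congr1 (fun q : {poly L} => q`_(size m).-2)).
    rewrite coef_deriv coef0 prednK -?subn1 ?subn_gt0 // subn1 => /eqP.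
    rewrite mulrn_eq0 -lead_coefE lead_coef_eq0 (negPf m0) orbF.
    by rewrite -subn1 subn_eq0 leqNgt sm.
  by rewrite leqNgt lt_size_deriv.
pose x' := - (map_poly D m).[x] / m^`().[x].
have jm : jet (D := D) x x' m = 0 by rewrite /jet /x' mulrC divfK // subrr.
(* Induction on the size: subtracting a multiple of m kills the leading term of p, and the jet of
   that multiple is 0 because m(x) and the jet of m both vanish. *)
exists x' => p; move: {2}(size p) (leqnn (size p)) => n.
elim: n p => [|n IHn] p sp Kp px.
  move: sp; rewrite leqn0 size_poly_eq0 => /eqP ->.
  by rewrite -polyC0 (jetC KD) (derivation0 KD).
have [p0|p0] := eqVneq p 0.
  by rewrite p0 -polyC0 (jetC KD) (derivation0 KD).
have smp : (size m <= size p)%N by apply: m_min; apply/asboolP; exists p.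
pose c := lead_coef p / lead_coef m.
pose q := c%:P * 'X^(size p - size m).
have Kq : coefs_in (K := K) q.
  apply: coefs_inM => //; last exact: coefs_inXn.
  by apply: coefs_inC => //; apply: subfield_div => //; rewrite lead_coefE.
have Kqm : coefs_in (K := K) (q * m) by exact: coefs_inM.
have sqm : size (q * m) = size p.
  rewrite /q -mulrA size_Cmul; last first.
    by rewrite mulf_neq0 ?invr_eq0 ?lead_coef_eq0.
  by rewrite mulrC size_mulXn // subnK.
have lqm : lead_coef (q * m) = lead_coef p.
  by rewrite /q !lead_coefM lead_coefC lead_coefXn mulr1 /c divfK ?lead_coef_eq0.
have jqm : jet (D := D) x x' (q * m) = 0.
  by rewrite (jetM KD) // jm mx !mulr0 addr0.
pose u := p - q * m; have : jet (D := D) x x' (u) = 0.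
  apply: IHn.
  - have s1 : (size (u) <= size p)%N.
      by rewrite (leq_trans (size_polyD _ _)) // size_polyN sqm maxnn.
    have [//|s2] := leqP (size (u)) n.
    have E : size (u) = size p.
      by apply/eqP; rewrite eqn_leq s1 (leq_trans sp).
    have : lead_coef (u) = 0.
      rewrite lead_coefE E /u coefB -lead_coefE.
      by rewrite -[in X in _ - X]sqm -lead_coefE lqm subrr.
    by move/eqP; rewrite lead_coef_eq0 -size_poly_eq0 => /eqP us; rewrite us in s2.
  - exact: coefs_inB.
  - by rewrite /u hornerD hornerN hornerM mx px mulr0 subrr.
by rewrite /u (jetB KD) // jqm subr0.
Qed.

Lemma algebraic_subfield :
  is_subfield (algebraicOver (ratr : rat -> L) : set L).
Proof.
split; [exact: algebraic1 | exact: algebraic_sub | exact: algebraic_div].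
Qed.

(** The zero derivation on the algebraic numbers extends to z with D z = 1, as only the zero
    polynomial over them vanishes at z; the entries of [ws] are then adjoined one at a time. *)
Lemma exists_derivation (z : L) (ws : seq L) :
  ~ algebraicOver (ratr : rat -> L) z ->
  exists K D, [/\ derivation_on K D, K z /\ D z = 1,
    forall c, algebraicOver (ratr : rat -> L) c -> K c /\ D c = 0 &
    forall w, w \in ws -> K w].
Proof.
move=> ztr; pose A : set L := algebraicOver (ratr : rat -> L).
have AD : derivation_on A (fun=> 0).
  split; first exact: algebraic_subfield.
    by move=> *; rewrite addr0.
  by move=> *; rewrite mul0r mulr0 addr0.
elim: ws => [|w ws [K [D [KD [Kz Dz] KA Kws]]]].
  have [|K [D [KD AK Kz Dz DA]]] := @extend_derivation _ _ _ AD z 1.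
    move=> p Ap pz; have [->|p0] := eqVneq p 0.
      by rewrite -polyC0 (jetC AD).
    case: ztr; apply/integral_algebraic; apply: (@integral_root _ _ _ p) => //.
      exact/eqP.
    by move=> _ /(nthP 0)[i _ <-]; apply/integral_algebraic/Ap.
  by exists K, D; split=> // c Ac; split; [exact: AK | exact: DA].
have [K1 [D1 [KD1 KK1 K1w D1E]]] := extend_derivation_to w KD.
exists K1, D1; split=> //.
- by split; [exact: KK1 | rewrite D1E].
- by move=> c /KA[Kc Dc]; split; [exact: KK1 | rewrite D1E].
- by move=> v; rewrite inE => /orP[/eqP ->|/Kws /KK1].
Qed.

End DerivationExistence.

(** * Logarithmic derivatives and algebraicity of the critical values *)

Section LogarithmicDerivative.
Context {L : fieldType} {K : set L} {D : L -> L}.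
Hypothesis KD : derivation_on K D.
Let Ksub : is_subfield K. Proof. by case: KD. Qed.

(* With x / 0 = 0 the logarithmic derivative vanishes at 0. *)
Definition dlog (x : L) : L := D x / x.

Lemma dlog1 : dlog 1 = 0.
Proof. by rewrite /dlog (derivation1 KD) mul0r. Qed.

Lemma dlogM x y : K x -> K y -> x != 0 -> y != 0 ->
  dlog (x * y) = dlog x + dlog y.
Proof.
by move=> Kx Ky x0 y0; rewrite /dlog (derivationM KD) //; field; rewrite x0 y0.
Qed.

Lemma dlogV x : K x -> x != 0 -> dlog x^-1 = - dlog x.
Proof.
move=> Kx x0; apply/eqP; rewrite -subr_eq0 opprK -dlogM ?invr_eq0 //.
  by rewrite mulVf // dlog1.
exact: subfieldV.
Qed.

Lemma dlogXz x m : K x -> x != 0 -> dlog (x ^ m) = m%:~R * dlog x.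
Proof.
move=> Kx x0.
have nat_case n : dlog (x ^+ n) = n%:R * dlog x.
  elim: n => [|n IHn]; first by rewrite dlog1 mul0r.
  rewrite exprS dlogM ?expf_neq0 //; last exact: subfieldX.
  by rewrite IHn -natr1 mulrDl mul1r addrC.
case: m => n; first exact: nat_case.
rewrite NegzE -exprnN dlogV ?expf_neq0 //; last exact: subfieldX.
by rewrite nat_case mulrNz mulNr.
Qed.

Lemma dlog_prod (I : finType) (P : pred I) (F : I -> L) :
  (forall i, P i -> K (F i)) -> (forall i, P i -> F i != 0) ->
  K (\prod_(i | P i) F i) /\
  dlog (\prod_(i | P i) F i) = \sum_(i | P i) dlog (F i).
Proof.
move=> KF F0.
suff [? _ ?] : [/\ K (\prod_(i | P i) F i), \prod_(i | P i) F i != 0 &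
  dlog (\prod_(i | P i) F i) = \sum_(i | P i) dlog (F i)] by [].
apply: (big_rec2 (fun u v => [/\ K u, u != 0 & dlog u = v])).
  by split; [exact: subfield1 | exact: oner_neq0 | exact: dlog1].
move=> i v u Pi [Ku u0 <-]; split.
- by apply: (subfieldM Ksub) => //; exact: KF.
- by rewrite mulf_neq0 // F0.
- by rewrite dlogM ?F0 //; exact: KF.
Qed.

End LogarithmicDerivative.
Arguments dlog {L} D x.

(* If D is a derivation with D z = 1, the variational equations give
   sum_j eps_j v_i(A_j) dlog A_j(w) = 0 for i > 0, and Euler's relation turns
   sum_j eps_j dA_j(w) = 0 into the same equation for i = 0. *)
Lemma CV_algebraic (R : realType) (r : nat) (t : hyp_term R r) :
  balanced t -> forall z, CV t z -> algebraic_number z.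
Proof.
move=> bal z [w Xw zE]; apply: contrapT => ztr.
have [K [D [KD [Kz Dz] KA Kws]]] :=
  exists_derivation [seq w 0 i | i : 'I_r] ztr.
have Ksub : is_subfield K by case: KD.
have Kw i : K (w 0 i) by apply/Kws/mapP; exists i; rewrite ?mem_enum.
have [C0 Calg _ _] := bal.
have KC i : K (tC t i) by have [] := KA _ (Calg i).
have dC i : dlog D (tC t i) = 0.
  by have [_ DC] := KA _ (Calg i); rewrite /dlog DC mul0r.
have Kint m : K m%:~R by apply: subfieldMz => //; exact: subfield1.
pose a j := dehom (tA t j) w.
have Ka j : K (a j).
  apply: subfieldD => //.
  by apply: subfield_sum => // i; apply: subfieldM.
have a0 j : a j = 0 -> tA t j = 0.
  by move=> aj; exact: variational_solution_form Xw _ aj (balanced_eps_neq0 bal).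
(* Zero forms enter with exponent 0 and the other factors are nonzero, so the logarithmic derivative
   can be taken factorwise. *)
have dprod (m : 'I_(tJ t) -> int) : (forall j, tA t j = 0 -> m j = 0) ->
    [/\ K (\prod_j a j ^ m j), \prod_j a j ^ m j != 0 &
        dlog D (\prod_j a j ^ m j) = \sum_j (m j)%:~R * dlog D (a j)].
  move=> m0.
  have am0 j : a j ^ m j != 0.
    have [aj|aj] := eqVneq (a j) 0; last exact: expfz_neq0.
    by rewrite (m0 j (a0 j aj)) expr0z oner_neq0.
  have [||Kp ->] := @dlog_prod _ _ _ KD _ xpredT (fun j => a j ^ m j).
  - by move=> j _; exact: subfieldXz.
  - by move=> j _; exact: am0.
  split=> //; first by apply/prodf_neq0.
  apply: eq_bigr => j _; have [aj|aj] := eqVneq (a j) 0; last first.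
    exact: (dlogXz KD).
  by rewrite (m0 j (a0 j aj)) expr0z (dlog1 KD) mul0r.
have v0 i j : tA t j = 0 -> teps t j * vcoef i (tA t j) = 0.
  by move=> ->; rewrite /vcoef mxE mulr0.
have eqs i : \sum_j (teps t j * vcoef (lift ord0 i) (tA t j))%:~R * dlog D (a j) = 0.
  have [Kp p0 dp] := dprod _ (v0 (lift ord0 i)).
  have := congr1 (dlog D) (Xw i).
  by rewrite (dlogM KD) // dC add0r (dlog1 KD) dp.
have eq0 : \sum_j (teps t j * vcoef ord0 (tA t j))%:~R * dlog D (a j) = 0.
  (* This is D applied to sum_j eps_j A_j(w) = 0. *)
  have E : \sum_j (teps t j)%:~R * D (a j) = 0.
    have Ke j : K ((teps t j)%:~R * a j) by apply: subfieldM.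
    transitivity (D (\sum_j (teps t j)%:~R * a j)); last first.
      by rewrite balanced_dehom // (derivation0 KD).
    rewrite (derivation_sum KD) //; apply: eq_bigr => j _.
    by rewrite !mulrzl (derivationMz KD).
  rewrite -[RHS]E.
  (* Adding the equations for i > 0 with weights w_i turns the coefficients v_0(A_j) into A_j(w). *)
  transitivity (\sum_j (teps t j * vcoef ord0 (tA t j))%:~R * dlog D (a j) +
    \sum_i w 0 i * \sum_j (teps t j * vcoef (lift ord0 i) (tA t j))%:~R * dlog D (a j)).
    by rewrite [X in _ + X]big1 ?addr0 // => i _; rewrite eqs mulr0.
  under [X in _ + X]eq_bigr do rewrite mulr_sumr.
  rewrite exchange_big /= -big_split /=; apply: eq_bigr => j _.
  transitivity ((teps t j)%:~R * (a j * dlog D (a j))); last first.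
    congr (_ * _); rewrite /dlog; have [aj|aj] := eqVneq (a j) 0.
      by rewrite aj (derivation0 KD) !mul0r.
    by rewrite mulrC divfK.
  rewrite /a /dehom mulrDl mulrDr mulr_suml mulr_sumr; congr (_ + _).
    by rewrite mulrA -intrM.
  by apply: eq_bigr => i _; rewrite intrM; ring.
have zE' : z = (tC t ord0)^-1 * \prod_j a j ^ (- (teps t j * vcoef ord0 (tA t j))).
  by rewrite -zE prod_dehom_neq0 //; exact: variational_notin_arrangement.
have [|Kp p0 dp] := dprod (fun j => - (teps t j * vcoef ord0 (tA t j))).
  by move=> j A0; rewrite v0 ?oppr0.
have dz : dlog D z = 0.
  rewrite zE' (dlogM KD) ?invr_eq0 //; last exact: subfieldV.
  rewrite (dlogV KD) // dC oppr0 add0r dp -[RHS]oppr0 -[in RHS]eq0 -sumrN.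
  by apply: eq_bigr => j _; rewrite mulrNz mulNr.
have z0 : z != 0 by rewrite zE' mulf_neq0 ?invr_eq0.
by move/eqP: dz; rewrite /dlog Dz mul1r invr_eq0 (negPf z0).
Qed.

(** * Sets in one variable definable over an algebraically closed field *)

Section DefinableSets.
Context {F : closedFieldType}.

Lemma rterm_poly (u : GRing.term F) : GRing.rterm u ->
  exists p : {poly F}, forall z, GRing.eval [:: z] u = p.[z].
Proof.
elim: u => //=.
- case=> [|n] _; first by exists 'X => z; rewrite hornerX.
  (* Every variable other than 0 is unassigned and reads as the default 0. *)
  by exists 0 => z; rewrite horner0 /= nth_nil.
- by move=> c _; exists c%:P => z; rewrite hornerC.
- by move=> n _; exists n%:R%:P => z; rewrite hornerC.
- move=> u1 IH1 u2 IH2 /andP[/IH1[p1 E1] /IH2[p2 E2]].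
  by exists (p1 + p2) => z; rewrite hornerD E1 E2.
- by move=> u1 IH1 /IH1[p1 E1]; exists (- p1) => z; rewrite hornerN E1.
- by move=> u1 IH1 n /IH1[p1 E1]; exists (p1 *+ n) => z; rewrite hornerMn E1.
- move=> u1 IH1 u2 IH2 /andP[/IH1[p1 E1] /IH2[p2 E2]].
  by exists (p1 * p2) => z; rewrite hornerM E1 E2.
- by move=> u1 IH1 n /IH1[p1 E1]; exists (p1 ^+ n) => z; rewrite horner_exp E1.
Qed.

(** These sets form a Boolean algebra. Over an algebraically closed field it contains every
    definable subset of the line: such fields are strongly minimal. *)
Definition fin_or_cofin (S : set F) := finite_set S \/ finite_set (~` S).

Lemma fin_or_cofinC S : fin_or_cofin S -> fin_or_cofin (~` S).
Proof. by case; [right; rewrite setCK | left]. Qed.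

Lemma fin_or_cofinU S T : fin_or_cofin S -> fin_or_cofin T -> fin_or_cofin (S `|` T).
Proof.
rewrite /fin_or_cofin setCU.
case=> fS; last by move=> _; right; apply: sub_finite_set fS; exact: subIsetl.
case=> fT; last by right; apply: sub_finite_set fT; exact: subIsetr.
by left; rewrite finite_setU.
Qed.

Lemma fin_or_cofinI S T : fin_or_cofin S -> fin_or_cofin T -> fin_or_cofin (S `&` T).
Proof.
move=> fS fT; rewrite -(setCK (S `&` T)) setCI.
by apply/fin_or_cofinC/fin_or_cofinU; exact: fin_or_cofinC.
Qed.

Lemma finite_roots (p : {poly F}) : p != 0 -> finite_set [set z | p.[z] = 0].
Proof.
move=> p0; have [s sE] := closed_field_poly_normal p.
apply: (@sub_finite_set _ _ [set` s]); last exact: finite_seq.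
move=> z /= /eqP; rewrite sE hornerZ mulf_eq0 lead_coef_eq0 (negPf p0) /=.
by rewrite -/(root _ _) root_prod_XsubC.
Qed.

(** An equation in one variable is the zero set of a polynomial, finite unless the polynomial is 0;
    connectives act as Boolean operations. *)
Lemma qf_definable (f : GRing.formula F) : GRing.qf_form f && GRing.rformula f ->
  fin_or_cofin [set z | GRing.qf_eval [:: z] f].
Proof.
elim: f => //=.
- case=> _; [right | left]; apply: sub_finite_set (finite_set0 F); last by [].
  by move=> z /= nz; case: nz.
- move=> u1 u2 /andP[/rterm_poly[p1 E1] /rterm_poly[p2 E2]].
  have -> : [set z | GRing.eval [:: z] u1 == GRing.eval [:: z] u2] =
      [set z | (p1 - p2).[z] = 0].
    apply/seteqP; split=> z /=; rewrite hornerD hornerN -E1 -E2.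
      by move/eqP->; rewrite subrr.
    by move/eqP; rewrite subr_eq0.
  have [->|p0] := eqVneq (p1 - p2) 0; last by left; exact: finite_roots.
  right; apply: sub_finite_set (finite_set0 F) => z /=.
  by rewrite horner0; apply.
- move=> f1 IH1 f2 IH2 /andP[/andP[q1 q2] /andP[r1 r2]].
  rewrite (_ : [set z | _] = [set z | GRing.qf_eval [:: z] f1] `&`
      [set z | GRing.qf_eval [:: z] f2]).
    by apply: fin_or_cofinI; [apply: IH1; rewrite q1 | apply: IH2; rewrite q2].
  by apply/seteqP; split=> z /= => [/andP[]|[-> ->]].
- move=> f1 IH1 f2 IH2 /andP[/andP[q1 q2] /andP[r1 r2]].
  rewrite (_ : [set z | _] = [set z | GRing.qf_eval [:: z] f1] `|`
      [set z | GRing.qf_eval [:: z] f2]).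
    by apply: fin_or_cofinU; [apply: IH1; rewrite q1 | apply: IH2; rewrite q2].
  by apply/seteqP; split=> z /= => [/orP|/orP].
- move=> f1 IH1 f2 IH2 /andP[/andP[q1 q2] /andP[r1 r2]].
  rewrite (_ : [set z | _] = ~` [set z | GRing.qf_eval [:: z] f1] `|`
      [set z | GRing.qf_eval [:: z] f2]).
    apply: fin_or_cofinU; last by apply: IH2; rewrite q2.
    by apply/fin_or_cofinC/IH1; rewrite q1.
  apply/seteqP; split=> z /=; rewrite implybE.
    by move=> /orP[/negP|]; [left | right].
  by move=> H; apply/orP; case: H => [/negP|]; [left | right].
- move=> f1 IH1 /IH1 fc.
  rewrite (_ : [set z | _] = ~` [set z | GRing.qf_eval [:: z] f1]).
    exact: fin_or_cofinC.
  by apply/seteqP; split=> z /= /negP.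
Qed.

Lemma definable_fin_or_cofin (f : GRing.formula F) :
  fin_or_cofin [set z | GRing.holds [:: z] f].
Proof.
(* [to_rform] first removes inverses, since quantifier elimination works on ring formulas. *)
pose qe := GRing.quantifier_elim (@ClosedFieldQE.ex_elim F) (GRing.to_rform f).
have rf := GRing.to_rform_rformula f.
have qP z : reflect (GRing.holds [:: z] (GRing.to_rform f)) (GRing.qf_eval [:: z] qe).
  apply: GRing.quantifier_elim_rformP rf.
    exact: ClosedFieldQE.wf_ex_elim.
  exact: ClosedFieldQE.holds_ex_elim (@GRing.solve_monicpoly F).
have -> : [set z | GRing.holds [:: z] f] = [set z | GRing.qf_eval [:: z] qe].
  apply/seteqP; split=> z /=; first by move/GRing.to_rformP/qP.
  by move/qP/GRing.to_rformP.
apply/qf_definable/GRing.quantifier_elim_wf => //.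
exact: ClosedFieldQE.wf_ex_elim.
Qed.

(** The quantified indices begin at [size e], so assigning each of them in turn appends its witness
    to the environment. *)
Lemma holds_exists_iota (f : GRing.formula F) n (e : seq F) :
  GRing.holds e (foldr GRing.Exists f (iota (size e) n)) <->
  exists2 w : seq F, size w = n & GRing.holds (e ++ w) f.
Proof.
elim: n e => [|n IHn] e /=.
  by split=> [H|[w /size0nil ->]]; [exists [::] | ]; rewrite ?cats0.
have set_nthE x : set_nth 0 e (size e) x = rcons e x.
  by elim: (e) => //= y e' ->.
split=> [[x]|[[|x w] // [sw] H]].
  rewrite set_nthE -(size_rcons e x) => /IHn[w sw H].
  by exists (x :: w); rewrite /= ?sw // -cat_rcons.
exists x; rewrite set_nthE -(size_rcons e x); apply/IHn.
by exists w; rewrite ?cat_rcons.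
Qed.

Lemma eval_sum_terms (I : Type) (s : seq I) (u : I -> GRing.term F) e :
  GRing.eval e (foldr (fun i => GRing.Add (u i)) (GRing.NatConst F 0) s) =
  \sum_(i <- s) GRing.eval e (u i).
Proof. by elim: s => [|i s IHs] /=; rewrite ?big_nil ?big_cons ?IHs. Qed.

Lemma eval_prod_terms (I : Type) (s : seq I) (u : I -> GRing.term F) e :
  GRing.eval e (foldr (fun i => GRing.Mul (u i)) (GRing.NatConst F 1) s) =
  \prod_(i <- s) GRing.eval e (u i).
Proof. by elim: s => [|i s IHs] /=; rewrite ?big_nil ?big_cons ?IHs. Qed.

Lemma holds_all (I : eqType) (s : seq I) (g : I -> GRing.formula F) e :
  GRing.holds e (foldr (fun i => GRing.And (g i)) (GRing.Bool true) s) <->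
  forall i, i \in s -> GRing.holds e (g i).
Proof.
elim: s => [|i s IHs] //=; split=> [[gi /IHs gs] j|gs].
  by rewrite inE => /orP[/eqP ->|/gs].
split; first by apply: gs; rewrite mem_head.
by apply/IHs => j js; apply: gs; rewrite inE js orbT.
Qed.

Definition expz_term (u : GRing.term F) (m : int) : GRing.term F :=
  match m with
  | Posz n => GRing.Exp u n
  | Negz n => GRing.Inv (GRing.Exp u n.+1)
  end.

Lemma eval_expz_term u m e :
  GRing.eval e (expz_term u m) = GRing.eval e u ^ m.
Proof. by case: m. Qed.

End DefinableSets.

(** * Transcendental numbers by counting *)

Section Transcendental.
Context {R : realType}.

Lemma countable_algebraic : countable [set z : CC R | algebraic_number z].
Proof.
have -> : [set z : CC R | algebraic_number z] =
    \bigcup_(p in [set p : {poly rat} | p != 0])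
      [set z | (map_poly (ratr : rat -> CC R) p).[z] = 0].
  apply/seteqP; split=> z [p p0 pz]; exists p => //; first exact/eqP.
  exact/eqP.
apply: bigcup_countable; first exact: countableP.
move=> p /= p0; apply/finite_set_countable/finite_roots.
by rewrite map_poly_eq0.
Qed.

(** Otherwise C, and with it the real interval from 0 to 1, would be countable, contradicting its
    Lebesgue measure 1. *)
Lemma infinite_transcendental :
  infinite_set [set z : CC R | ~ algebraic_number z].
Proof.
move=> fin.
have : countable [set: CC R].
  rewrite -(setUv [set z : CC R | algebraic_number z]) -bigcup2inE.
  apply: bigcup_countable; first exact: countableP.
  case=> [|[|n]] //= _; first exact: countable_algebraic.
  exact: finite_set_countable.
move=> /countable_injP[f finj].
have : countable `[0%R, 1%R : R]%classic.
  apply/countable_injP; exists (f \o real_complex R) => x y _ _ /=.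
  by move=> /finj; rewrite !in_setT => /(_ isT isT) -[].
move/countable_lebesgue_measure0; rewrite lebesgue_measure_itv /= lte_fin ltr01.
by rewrite oppr0 adde0 => /eqP; rewrite eqe oner_eq0.
Qed.

End Transcendental.

(** * Critical values as a definable set *)

Section CriticalValuesFinite.
Context {R : realType} {r : nat} (t : hyp_term R r).

Let form_term (j : 'I_(tJ t)) : GRing.term (CC R) :=
  GRing.Add (GRing.Const ((vcoef ord0 (tA t j))%:~R : CC R))
    (foldr (fun i : 'I_r => GRing.Add (GRing.Mul
         (GRing.Const ((vcoef (lift ord0 i) (tA t j))%:~R : CC R))
         (GRing.Var _ i.+1)))
       (GRing.NatConst _ 0) (enum 'I_r)).

Let monomial_term (c : CC R) (m : 'I_(tJ t) -> int) : GRing.term (CC R) :=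
  GRing.Mul (GRing.Const c)
    (foldr (fun j => GRing.Mul (expz_term (form_term j) (m j)))
       (GRing.NatConst _ 1) (enum 'I_(tJ t))).

(* The value z is the variable 0 and w_i the variable i + 1. *)
Let CV_formula : GRing.formula (CC R) :=
  foldr (GRing.Exists (R := CC R))
    (GRing.And
      (GRing.Equal (GRing.Var _ 0)
        (monomial_term (tC t ord0)^-1
           (fun j => - (teps t j * vcoef ord0 (tA t j)))))
      (foldr (fun i : 'I_r => GRing.And
          (GRing.Equal
            (monomial_term (tC t (lift ord0 i))
               (fun j => teps t j * vcoef (lift ord0 i) (tA t j)))
            (GRing.NatConst _ 1)))
        (GRing.Bool true) (enum 'I_r)))
    (iota 1 r).

Let eval_form (z : CC R) (w : 'rV[CC R]_r) (e : seq (CC R)) j :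
  (forall i : 'I_r, e`_i = w 0 i) ->
  GRing.eval (z :: e) (form_term j) = dehom (tA t j) w.
Proof.
move=> ew; rewrite /form_term [LHS]/= eval_sum_terms big_enum /=.
by congr (_ + _); apply: eq_bigr => i _; rewrite ew.
Qed.

Let eval_monomial (z : CC R) (w : 'rV[CC R]_r) (e : seq (CC R)) c m :
  (forall i : 'I_r, e`_i = w 0 i) ->
  GRing.eval (z :: e) (monomial_term c m) = c * \prod_j dehom (tA t j) w ^ m j.
Proof.
move=> ew; rewrite /monomial_term [LHS]/= eval_prod_terms big_enum /=.
by congr (_ * _); apply: eq_bigr => j _; rewrite eval_expz_term (eval_form z j ew).
Qed.

Hypothesis bal : balanced t.

(** The product in the formula runs over all forms, so that a single term expresses it; on solutions
    it agrees with the product over nonvanishing forms. *)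
Let CV_holds : CV t = [set z | GRing.holds [:: z] CV_formula].
Proof.
have val w : variational_solutions t w ->
    (tC t ord0)^-1 * \prod_(j | dehom (tA t j) w != 0)
      dehom (tA t j) w ^ (- (teps t j * vcoef ord0 (tA t j))) =
    (tC t ord0)^-1 *
      \prod_j dehom (tA t j) w ^ (- (teps t j * vcoef ord0 (tA t j))).
  by move=> Xw; rewrite prod_dehom_neq0 //; exact: variational_notin_arrangement.
apply/seteqP; split=> z.
  move=> [w Xw <-]; rewrite val //; apply/(@holds_exists_iota _ _ r [:: _]).
  exists [seq w 0 i | i : 'I_r]; first by rewrite size_map size_enum_ord.
  have ew (i : 'I_r) : [seq w 0 i | i : 'I_r]`_i = w 0 i.
    by rewrite (nth_map i) ?size_enum_ord // nth_ord_enum.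
  split; first exact: esym (eval_monomial _ _ _ ew).
  by apply/holds_all => i _; exact: etrans (eval_monomial _ _ _ ew) (Xw i).
move=> /(@holds_exists_iota _ _ r [:: z])[e se [zE /holds_all eqs]].
pose w : 'rV[CC R]_r := \row_i e`_i.
have ew (i : 'I_r) : e`_i = w 0 i by rewrite mxE.
have Xw : variational_solutions t w.
  move=> i; have ie : i \in enum 'I_r by rewrite mem_enum.
  exact: etrans (esym (eval_monomial _ _ _ ew)) (eqs i ie).
exists w => //; rewrite val //.
exact: etrans (esym (eval_monomial _ _ _ ew)) (esym zE).
Qed.

(* A constructible subset of C is finite or cofinite, and a cofinite one
   contains transcendental numbers. *)
Lemma CV_finite : finite_set (CV t).
Proof.
have := definable_fin_or_cofin CV_formula; rewrite -CV_holds => -[//|cofin].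
case: (@infinite_transcendental R); apply: sub_finite_set cofin => z ztr Cz.
exact/ztr/(CV_algebraic bal).
Qed.

End CriticalValuesFinite.

(** * Finiteness of the set of faces *)

Section Faces.
Context {R : realType} {r : nat} (t : hyp_term R r).

Lemma dehom_affine_comb (F : comPzRingType) (A : 'rV[int]_r.+1) (I : finType)
    (c : I -> F) (w : I -> 'rV[F]_r) : \sum_k c k = 1 ->
  dehom A (\sum_k c k *: w k) = \sum_k c k * dehom A (w k).
Proof.
move=> c1; rewrite /dehom.
under [RHS]eq_bigr do rewrite mulrDr mulr_sumr.
rewrite big_split /= -mulr_suml c1 mul1r exchange_big /=; congr (_ + _).
apply: eq_bigr => i _; rewrite summxE mulr_sumr; apply: eq_bigr => k _.
by rewrite !mxE mulrCA.
Qed.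

(* The witness w0 is a point of the relative interior of D, and w0 + e (w0 - w)
   stays in the polytope for small e. *)
Lemma face_active_set (D : set 'rV[R]_r) : is_face (newton_polytope t) D ->
  exists I : {set 'I_(tJ t)}, D = newton_polytope t `&`
    [set w | forall j, j \in I -> dehom (tA t j) w = 0].
Proof.
case=> -[d Dd] [c [b [fb DE]]].
pose f (w : 'rV[R]_r) := \sum_i c 0 i * w 0 i.
have {}fb : forall w, newton_polytope t w -> f w <= b := fb.
have {}DE : D = newton_polytope t `&` [set w | f w = b] := DE.
exists [set j | `[< forall w, D w -> dehom (tA t j) w = 0 >]]%SET.
apply/seteqP; split=> w.
  move=> Dw; split; first by move: Dw; rewrite DE => -[].
  by move=> j; rewrite inE => /asboolP; apply.
move=> [Pw Iw].
(* A point of D where A_j is positive, if there is one; the barycentre of these points makes all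
   such forms positive at once. *)
have /choice[v vP] (j : 'I_(tJ t)) : exists v, D v /\
    ((exists2 u, D u & dehom (tA t j) u != 0) -> 0 < dehom (tA t j) v).
  have [[u Du uj]|nu] := pselect (exists2 u, D u & dehom (tA t j) u != 0).
    exists u; split=> // _; rewrite lt_neqAle eq_sym uj /=.
    by move: Du; rewrite DE => -[+ _]; apply.
  by exists d; split=> // u; case: nu.
(* The extra index [None], carrying d, keeps the family nonempty even when t has no forms. *)
pose N : R := #|{: option 'I_(tJ t)}|%:R.
have N0 : 0 < N by rewrite ltr0n card_option.
pose vv (o : option 'I_(tJ t)) := if o is Some j then v j else d.
have Dvv o : D (vv o) by case: o => [j|] //=; case: (vP j).
pose w0 := \sum_o N^-1 *: vv o.
have cN : \sum_(o : option 'I_(tJ t)) N^-1 = 1.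
  by rewrite sumr_const -[_ *+ _]mulr_natr mulVf // gt_eqF.
have fw0 : f w0 = b.
  transitivity (\sum_o N^-1 * f (vv o)).
    rewrite /f /w0; under [RHS]eq_bigr do rewrite mulr_sumr.
    rewrite exchange_big /=; apply: eq_bigr => i _.
    rewrite summxE mulr_sumr; apply: eq_bigr => o _.
    by rewrite mxE mulrCA.
  rewrite (eq_bigr (fun=> N^-1 * b)); last first.
    by move=> o _; have := Dvv o; rewrite DE => -[_ /= ->].
  by rewrite -mulr_suml cN mul1r.
have Avv j o : 0 <= dehom (tA t j) (vv o).
  by have := Dvv o; rewrite DE => -[+ _]; apply.
have Aw0 j : dehom (tA t j) w0 = \sum_o N^-1 * dehom (tA t j) (vv o).
  exact: dehom_affine_comb.
have Aw0_ge0 j : 0 <= dehom (tA t j) w0.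
  by rewrite Aw0 sumr_ge0 // => o _; rewrite mulr_ge0 // invr_ge0 ltW.
have Aw0_gt0 j : dehom (tA t j) w != 0 -> 0 < dehom (tA t j) w0.
  move=> wj; have vj : 0 < dehom (tA t j) (v j).
    apply: (vP j).2; apply: contrapT => nu; move/eqP: wj; apply; apply: Iw.
    rewrite inE; apply/asboolP => u Du; apply: contrapT => /eqP uj.
    by apply: nu; exists u.
  rewrite Aw0 (bigD1 (Some j)) //= ltr_wpDr ?mulr_gt0 ?invr_gt0 //.
  by apply: sumr_ge0 => o _; rewrite mulr_ge0 // invr_ge0 ltW.
have [e e0 He] : exists2 e, 0 < e &
    forall j, e * dehom (tA t j) w <= dehom (tA t j) w0.
  (* The ratios bound e for the forms positive at w; the others impose nothing, as A_j(w0) >= 0. *)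
  exists (\big[Num.min/1]_(j | dehom (tA t j) w != 0)
      (dehom (tA t j) w0 / dehom (tA t j) w)).
    apply: lt_bigmin => // j wj; rewrite divr_gt0 ?Aw0_gt0 //.
    by rewrite lt_neqAle eq_sym wj Pw.
  move=> j; have [->|wj] := eqVneq (dehom (tA t j) w) 0; first by rewrite mulr0.
  rewrite -ler_pdivlMr; last by rewrite lt_neqAle eq_sym wj Pw.
  exact: bigmin_le_cond.
pose cc (o : bool) := if o then 1 + e else - e.
pose ww (o : bool) := if o then w0 else w.
pose u := \sum_o cc o *: ww o.
have cc1 : \sum_o cc o = 1 by rewrite big_bool /= addrK.
have Pu : newton_polytope t u.
  move=> j; rewrite dehom_affine_comb // big_bool /= mulNr subr_ge0.
  by rewrite mulrDl mul1r (le_trans (He j)) // lerDl mulr_ge0 // ltW.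
have := fb u Pu.
have -> : f u = (1 + e) * f w0 - e * f w.
  rewrite /f /u !mulr_sumr -sumrB; apply: eq_bigr => i _.
  by rewrite big_bool /= !mxE; ring.
(* As f(w0) = b, the inequality f(u) <= b amounts to e b <= e f(w). *)
rewrite fw0 DE => H; split=> //=; apply/eqP; rewrite eq_le fb //=.
by rewrite -(ler_pM2l e0); move: H; lra.
Qed.

Lemma finite_faces : finite_set [set D | is_face (newton_polytope t) D].
Proof.
apply: (@sub_finite_set _ _ ((fun I : {set 'I_(tJ t)} => newton_polytope t `&`
    [set w | forall j, j \in I -> dehom (tA t j) w = 0]) @` setT)).
  by move=> D /face_active_set[I ->]; exists I.
exact/finite_image/finite_finset.
Qed.

End Faces.

(** * Independence of the critical values from the parametrization *)

Section ChangeOfParametrization.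
Context {R : realType}.

Lemma restrict_restrict (q r s : nat) (t : hyp_term R r)
    (phi : 'M[int]_(s.+1, r.+1)) (U : 'M[int]_(q.+1, s.+1)) : balanced t ->
  restrict_term (restrict_term t phi) U = restrict_term t (U *m phi).
Proof.
case=> C0 _ _ _.
rewrite /restrict_term /=.
have -> : (fun l => \prod_k (\prod_i tC t i ^ phi k i) ^ U l k) =
    (fun l => \prod_i tC t i ^ (U *m phi) l i).
  apply/funext => l.
  transitivity (\prod_k \prod_i tC t i ^ (U l k * phi k i)).
    apply: eq_bigr => k _.
    rewrite (big_morph (fun a => a ^ U l k) (fun a b => expfzMl a b _) (exp1rz _ _)).
    by apply: eq_bigr => i _; rewrite exprz_exp mulrC.
  rewrite exchange_big; apply: eq_bigr => i _; rewrite mxE.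
  by rewrite (big_morph _ (fun a b => expfzDr a b (C0 i)) (expr0z _)).
have -> // : (fun j => tA t j *m phi^T *m U^T) = (fun j => tA t j *m (U *m phi)^T).
by apply/funext => j; rewrite trmx_mul mulmxA.
Qed.

(** Row i of U lists the exponents with which the monomials of t combine. The values [a] are shared
    because the substitution will preserve the values of the forms; exponents may be added because a
    zero value comes only from a zero form. *)
Lemma monomial_restrict (s s' : nat) (t : hyp_term R s)
    (U : 'M[int]_(s'.+1, s.+1)) (a : 'I_(tJ t) -> CC R) : balanced t ->
  (forall j, a j = 0 -> tA t j = 0) -> forall i,
  tC (restrict_term t U) i *
    \prod_j a j ^ (teps t j * vcoef i (tA t j *m U^T)) =
  \prod_l (tC t l * \prod_j a j ^ (teps t j * vcoef l (tA t j))) ^ U i l.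
Proof.
move=> bal a0 i.
under [RHS]eq_bigr do rewrite expfzMl.
rewrite big_split /=; congr (_ * _).
transitivity (\prod_l \prod_j a j ^ (teps t j * vcoef l (tA t j) * U i l)).
  rewrite exchange_big /=; apply: eq_bigr => j _.
  have [aj|aj] := eqVneq (a j) 0.
    rewrite (a0 j aj) mul0mx /vcoef mxE mulr0 expr0z big1 // => l _.
    by rewrite mxE mulr0 mul0r expr0z.
  rewrite /vcoef mxE mulr_sumr.
  rewrite (big_morph _ (fun m n => expfzDr m n aj) (expr0z _)).
  by apply: eq_bigr => l _; rewrite mxE mulrA.
apply: eq_bigr => l _.
rewrite (big_morph (fun b => b ^ U i l) (fun b c => expfzMl b c _) (exp1rz _ _)).
by apply: eq_bigr => j _; rewrite exprz_exp.
Qed.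

(** U carries a solution w to a point w' where the restricted forms take the same values. Rows of U'
    below the first combine variational monomials, all equal to 1; the first row adds the monomial
    of index 0 exactly once. *)
Lemma CV_restrict_sub (s s' : nat) (t : hyp_term R s)
    (U : 'M[int]_(s.+1, s'.+1)) (U' : 'M[int]_(s'.+1, s.+1)) : balanced t ->
  U *m U' = 1%:M -> U ord0 ord0 = 1 -> U' ord0 ord0 = 1 ->
  (forall l : 'I_s, U (lift ord0 l) ord0 = 0) ->
  (forall l : 'I_s', U' (lift ord0 l) ord0 = 0) ->
  CV t `<=` CV (restrict_term t U').
Proof.
move=> bal UU' U00 U'00 Ul0 U'l0 z [w Xw <-].
pose w' := affine_param U w.
have bal' := balanced_restrict U' bal.
have U00n0 : (U ord0 ord0)%:~R != 0 :> CC R by rewrite U00 oner_neq0.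
have aE j : dehom (tA t j *m U'^T) w' = dehom (tA t j) w.
  rewrite -[RHS](_ : dehom (tA t j *m U'^T *m U^T) w = _); last first.
    by rewrite -mulmxA -trmx_mul UU' trmx1 mulmx1.
  by rewrite (dehom_restrict Ul0 U00n0) U00 mulr1z mul1r.
have a0 j : dehom (tA t j) w = 0 -> tA t j = 0.
  by move=> aj; exact: variational_solution_form Xw _ aj (balanced_eps_neq0 bal).
have M := monomial_restrict U' bal a0.
have X' : variational_solutions (restrict_term t U') w'.
  move=> i; under eq_bigr do rewrite aE.
  rewrite M big_ord_recl U'l0 expr0z mul1r big1 // => l _.
  by rewrite Xw exp1rz.
have arr := variational_notin_arrangement bal Xw.
have arr' := variational_notin_arrangement bal' X'.
exists w'; first exact: X'.
rewrite -(prod_dehom_neq0 arr) -(prod_dehom_neq0 arr').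
(* A critical value is the inverse of the monomial of index 0. *)
have invE (m : 'I_(tJ t) -> int) (a : 'I_(tJ t) -> CC R) (c : CC R) :
    c^-1 * \prod_j a j ^ (- m j) = (c * \prod_j a j ^ m j)^-1.
  rewrite invfM; congr (_ * _); rewrite -prodfV.
  by apply: eq_bigr => j _; rewrite invr_expz.
rewrite !invE; congr (_^-1).
under eq_bigr do rewrite aE.
rewrite M big_ord_recl U'00 expr1z -[RHS]mulr1; congr (_ * _).
by apply: big1 => l _; rewrite Xw exp1rz.
Qed.

Lemma face_param_row (r s : nat) (D : set 'rV[R]_r) (phi : 'M[int]_(s.+1, r.+1)) :
  face_param D phi -> forall l, cone_span D (map_mx intr (row l phi)).
Proof. by case=> _ _ _ span l; apply/span; exists (delta_mx 0 l); rewrite rowE. Qed.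

(** Each row of phi lies in the cone span, hence is an integral combination of the rows of psi.
    Comparing first columns, where psi has a nonzero entry only in row 0, gives the shape of U. *)
Lemma face_param_transition (r s s' : nat) (D : set 'rV[R]_r)
    (phi : 'M[int]_(s.+1, r.+1)) (psi : 'M[int]_(s'.+1, r.+1)) :
  face_param D phi -> face_param D psi ->
  exists U : 'M[int]_(s.+1, s'.+1), [/\ phi = U *m psi,
    phi ord0 ord0 = U ord0 ord0 * psi ord0 ord0 &
    forall l : 'I_s, U (lift ord0 l) ord0 = 0].
Proof.
move=> phiD psiD.
have /choice[x xE] l : exists x, row l phi = x *m psi.
  by case: (psiD) => _ _ _ span; apply/span/(face_param_row phiD).
have [U E] : exists U, phi = U *m psi.
  by exists (\matrix_l x l); apply/row_matrixP => l; rewrite row_mul rowK.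
have col0 l : phi l ord0 = U l ord0 * psi ord0 ord0.
  case: psiD => _ psi0 _ _; rewrite {1}E mxE big_ord_recl big1 ?addr0 // => k _.
  by rewrite psi0 mulr0.
exists U; split=> // l; apply/eqP.
case: phiD psiD => _ phi0 _ _ [psi00 _ _ _].
have /eqP := col0 (lift ord0 l); rewrite phi0 eq_sym mulf_eq0.
by rewrite (gt_eqF psi00) orbF.
Qed.

(* Two parametrizations of the same lattice differ by a unimodular matrix. *)
Lemma CV_face_param (r s s' : nat) (t : hyp_term R r) (D : set 'rV[R]_r)
    (phi : 'M[int]_(s.+1, r.+1)) (psi : 'M[int]_(s'.+1, r.+1)) : balanced t ->
  face_param D phi -> face_param D psi ->
  CV (restrict_term t phi) `<=` CV (restrict_term t psi).
Proof.
move=> bal phiD psiD.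
have [U [phiE U00 Ul0]] := face_param_transition phiD psiD.
have [U' [psiE U'00 U'l0]] := face_param_transition psiD phiD.
rewrite [in X in _ `<=` X]psiE -restrict_restrict //.
have [phi00 _ phi_inj _] := phiD; have [psi00 _ _ _] := psiD.
(* U U' phi = phi, and phi is injective on integral rows. *)
have UU' : U *m U' = 1%:M.
  apply/row_matrixP => l; apply: phi_inj.
  by rewrite /= -!row_mul -mulmxA -psiE -phiE mul1mx.
have UU00 : U ord0 ord0 * U' ord0 ord0 = 1.
  move: U00; rewrite U'00 mulrA => /esym/eqP.
  rewrite -subr_eq0 -{2}[phi _ _]mul1r -mulrBl mulf_eq0 (gt_eqF phi00) orbF.
  by rewrite subr_eq0 => /eqP.
have U_gt0 : 0 < U ord0 ord0 by move: phi00; rewrite U00 pmulr_lgt0.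
have U'_gt0 : 0 < U' ord0 ord0 by move: psi00; rewrite U'00 pmulr_lgt0.
have [U1 U'1] : U ord0 ord0 = 1 /\ U' ord0 ord0 = 1 by nia.
by apply: (@CV_restrict_sub _ _ _ U) => //; exact: balanced_restrict.
Qed.

(** A finite union over faces: all parametrizations of one face contribute the critical values of a
    single one, and a face without parametrization contributes nothing. *)
Lemma S_set_finite (r : nat) (t : hyp_term R r) : balanced t ->
  finite_set (S_set t).
Proof.
move=> bal; rewrite /S_set finite_setU; split; first exact: finite_set1.
pose T (D : set 'rV[R]_r) := [set z | exists (s : nat) (phi : 'M[int]_(s.+1, r.+1)),
  face_param D phi /\ CV (restrict_term t phi) z].
apply: (@sub_finite_set _ _
  (\bigcup_(D in [set D | is_face (newton_polytope t) D]) T D)).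
  by move=> z [D [s [phi [Dface Dphi zCV]]]]; exists D => //; exists s, phi.
apply: bigcup_finite; first exact: finite_faces.
move=> D _; have [[s [phi Dphi]]|nphi] :=
    pselect (exists (s : nat) (phi : 'M[int]_(s.+1, r.+1)), face_param D phi).
  apply: (@sub_finite_set _ _ (CV (restrict_term t phi))).
    by move=> z [s' [psi [Dpsi]]]; exact: (CV_face_param bal Dpsi Dphi).
  exact/CV_finite/balanced_restrict.
apply: sub_finite_set (finite_set0 _) => z [s [phi [Dphi _]]].
by apply: nphi; exists s, phi.
Qed.

Lemma S_set_algebraic (r : nat) (t : hyp_term R r) : balanced t ->
  forall z, S_set t z -> algebraic_number z.
Proof.
move=> bal z [->|[D [s [phi [_ _]]]]]; first exact: algebraic0.
exact/CV_algebraic/balanced_restrict.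
Qed.

End ChangeOfParametrization.

(** * The field generated by finitely many algebraic numbers *)

Section NumberField.
Context {R : realType}.

Let ev (q : {poly rat}) (z : CC R) : CC R := (map_poly ratr q).[z].

Let evD q q' z : ev (q + q') z = ev q z + ev q' z.
Proof. by rewrite /ev (rmorphD (map_poly ratr)) hornerD. Qed.

Let evM q q' z : ev (q * q') z = ev q z * ev q' z.
Proof. by rewrite /ev (rmorphM (map_poly ratr)) hornerM. Qed.

(** Induction with the primitive element theorem in characteristic 0: for some n, both x and z are
    polynomials in n x - z. *)
Lemma algebraic_primitive_element (s : seq (CC R)) :
  (forall x, x \in s -> algebraic_number x) ->
  exists2 z : CC R, algebraic_number z & forall x, x \in s -> exists q, x = ev q z.
Proof.
elim: s => [|x s IHs] algs; first by exists 0; first exact: algebraic0.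
have [|z algz zs] := IHs; first by move=> y ys; apply: algs; rewrite inE ys orbT.
have algx : algebraic_number x by apply: algs; rewrite mem_head.
have [p p0 pz] := algz; have [q q0 qx] := algx.
have [n [[pz' Ez] [px' Ex]]] := pchar0_PET p0 pz q0 qx (@pchar_num rat).
exists (x *+ n - z).
  apply: algebraic_sub => //; rewrite -mulr_natr; apply: algebraic_mul => //.
  by rewrite -(ratr_nat (CC R)); exact: algebraic_id.
move=> y; rewrite inE => /orP[/eqP ->|/zs[g ->]]; first by exists px'.
by exists (g \Po pz'); rewrite /ev map_comp_poly horner_comp Ez.
Qed.

Lemma minimal_annihilator (z : CC R) : algebraic_number z ->
  exists p : {poly rat}, [/\ p != 0, ev p z = 0 &
    forall q, q != 0 -> ev q z = 0 -> (size p <= size q)%N].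
Proof.
case=> p0 p00 /rootP p0z.
pose ann n := `[< exists p, [/\ p != 0, ev p z = 0 & size p = n] >].
have exn : exists n, ann n by exists (size p0); apply/asboolP; exists p0.
case: (ex_minnP exn) => n /asboolP[p [pn0 pz <-]] pmin.
by exists p; split=> // q q0 qz; apply: pmin; apply/asboolP; exists q.
Qed.

(** Division is the only issue: a polynomial q' not vanishing at z is coprime to the minimal
    annihilator p of z, and the Bezout relation evaluated at z inverts q'(z). *)
Lemma simple_extension_subfield (z : CC R) : algebraic_number z ->
  is_subfield [set x | exists q, x = ev q z].
Proof.
move=> /minimal_annihilator[p [p0 pz pmin]]; split.
- by exists 1; rewrite /ev rmorph1 hornerC.
- by move=> _ _ [q ->] [q' ->]; exists (q - q'); rewrite /ev rmorphB hornerD hornerN.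
- move=> _ _ [q ->] [q' ->].
  have [q'z|q'z] := eqVneq (ev q' z) 0.
    by exists 0; rewrite q'z invr0 mulr0 /ev rmorph0 horner0.
  (* With g the gcd and p = h g, g(z) is nonzero, so h(z) = 0 and minimality of p makes g
     constant. *)
  have cop : coprimep p q'.
    have [h hE] := dvdpP _ _ (dvdp_gcdl p q').
    have [k kE] := dvdpP _ _ (dvdp_gcdr p q').
    have gz : ev (gcdp p q') z != 0.
      by apply: contraNneq q'z => gz; rewrite kE evM gz mulr0.
    have hz : ev h z = 0.
      move: pz; rewrite hE evM => /eqP; rewrite mulf_eq0.
      by rewrite (negPf gz) orbF => /eqP.
    have h0 : h != 0 by apply: contraNneq p0 => h0; rewrite hE h0 mul0r.
    have g0 : gcdp p q' != 0 by rewrite gcdp_eq0 negb_and p0.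
    have := pmin h h0 hz; rewrite {1}hE size_mul //.
    rewrite /coprimep eqn_leq size_poly_gt0 g0 andbT.
    have : (0 < size h)%N by rewrite size_poly_gt0.
    by move: (size h) (size (gcdp p q')) => a b; lia.
  have /Bezout_coprimepP[[a b] /= abE] := cop.
  have [c c0 cE] : exists2 c : rat, c != 0 & a * p + b * q' = c%:P.
    move: abE; rewrite -size_poly_eq1 => /size_poly1P[c c0 cE].
    by exists c.
  exists (q * (c^-1 *: b)).
  have : ev (a * p + b * q') z = ratr c by rewrite cE /ev map_polyC hornerC.
  rewrite evD !evM pz mulr0 add0r => E.
  have -> : ev (c^-1 *: b) z = (ratr c)^-1 * ev b z.
    by rewrite /ev map_polyZ hornerZ fmorphV.
  congr (_ * _); apply: (mulIf q'z).
  by rewrite mulVf // -mulrA E mulVf // fmorph_eq0.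
Qed.

Lemma generated_field_subfield (F : fieldType) (S : set F) :
  is_subfield (generated_field S).
Proof.
split=> [K [] //|x y Sx Sy K KF SK|x y Sx Sy K KF SK].
  by apply: subfieldB => //; [exact: Sx | exact: Sy].
by apply: subfield_div => //; [exact: Sx | exact: Sy].
Qed.

(** Everything lies in Q[z] for a primitive element z, and reduction modulo an annihilator of z
    leaves finitely many powers of z. *)
Lemma number_field_generated (S : set (CC R)) : finite_set S ->
  (forall z, S z -> algebraic_number z) -> number_field (generated_field S).
Proof.
move=> /finite_seqP[s ->] algS.
have [z algz zs] := algebraic_primitive_element algS.
split; first exact: generated_field_subfield.
have [p [p0 pz _]] := minimal_annihilator algz.
exists (size p), (fun i : 'I_(size p) => z ^+ i) => x.
move=> /(_ _ (simple_extension_subfield algz)) [|q ->]; first by move=> y /zs.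
exists (fun i => (q %% p)`_i).
transitivity (ev (q %% p) z).
  by rewrite {1}(divp_eq q p) evD evM pz mulr0 add0r.
rewrite /ev (@horner_coef_wide _ (size p)).
  by apply: eq_bigr => i _; rewrite coef_map.
by rewrite (leq_trans (size_poly _ _)) // ltnW // ltn_modp.
Qed.

End NumberField.

Unset Implicit Arguments.

Theorem theorem2p3 (R : realType) (r : nat) (t : hyp_term R r)
    (t_balanced : balanced t)
    (P_compact : compact (newton_polytope t))
    (P_interior : interior (newton_polytope t) !=set0) :
  (forall (E : topologicalType) (p : E -> 'rV[CC R]_r),
    universal_abelian_cover (~` arrangement t) p ->
    forall lA : 'I_(tJ t) -> E -> CC R, log_branches t p lA ->
    (* (a) *)
    p @^-1` variational_solutions t =
      [set e | exists2 lC, log_constants t lC &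
                 critical_point p (lifted_potential t p lC lA) e] /\
    (* (b) *)
    (forall lC e, log_constants t lC ->
      critical_point p (lifted_potential t p lC lA) e ->
      cexp (- lifted_potential t p lC lA e) =
        (tC t ord0)^-1 *
        \prod_j dehom (tA t j) (p e) ^ (- (teps t j * vcoef ord0 (tA t j))) /\
      (tC t ord0)^-1 *
        \prod_j dehom (tA t j) (p e) ^ (- (teps t j * vcoef ord0 (tA t j))) =
        (tC t ord0)^-1 *
        \prod_(j | dehom (tA t j) (p e) != 0)
          dehom (tA t j) (p e) ^ (- (teps t j * vcoef ord0 (tA t j)))) /\
    CV t =
      [set z | exists lC e,
        [/\ log_constants t lC,
            critical_point p (lifted_potential t p lC lA) e &
            z = cexp (- lifted_potential t p lC lA e)]])
  /\
  (* (c) *)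
  (forall (D : set 'rV[R]_r) (s : nat) (phi : 'M[int]_(s.+1, r.+1)),
    is_face (newton_polytope t) D -> face_param D phi ->
    forall lC, log_constants t lC ->
    log_constants (restrict_term t phi) (restrict_logs phi lC) /\
    forall (E : topologicalType) (p : E -> 'rV[CC R]_s),
      universal_abelian_cover (~` arrangement (restrict_term t phi)) p ->
      potential_branches (restrict_term t phi) p (restrict_logs phi lC) =
      [set (fun e => (phi ord0 ord0)%:~R * V e)
        | V in potential_branches t (affine_param phi \o p) lC])
  /\
  (* (d) *)
  [/\ finite_set (S_set t),
      forall z, S_set t z -> algebraic_number z &
      number_field (generated_field (S_set t))].
Proof.
split; [|split].
- move=> E p [[pcov _ _ _] _] lA lAb.
  have arr e : ~ arrangement t (p e).
    by case: pcov => _ prange _; have : range p (p e) by []; rewrite prange.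
  split; first exact: variational_critical.
  split; last exact: CV_critical_values.
  move=> lC e lCt cr; split; first exact: critical_value_formula.
  by rewrite prod_dehom_neq0.
- move=> D s phi _ [phi00 phil0 _ _] lC lCt.
  split; first exact: restrict_log_constants.
  by move=> E p _; exact: potential_branches_restrict.
- split; [exact: S_set_finite | exact: S_set_algebraic |].
  by apply: number_field_generated; [exact: S_set_finite | exact: S_set_algebraic].
Qed.
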